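(* Let $\mu$ be a Borel probability measure on $\mathbb{C}$ with compact support. If there exists $c\in\mathbb{C}$ with $\operatorname{supp}\mu\subset\overline{B}(c,r_{\mathrm{bif}}(c))$, then the polynomial semigroup $G_\mu$ has a planar minimal set. If there exists $c\in\mathbb{C}$ with $\operatorname{int}(\operatorname{supp}\mu)\supset\overline{B}(c,r_{\mathrm{bif}}(c))$, then the random Julia set $J_\omega$ is totally disconnected for $\mathbb{P}_\mu$-almost every $\omega\in\Omega_\mu$.
   Context: $f_c(z)=z^2+c$, extended to $\widehat{\mathbb{C}}$ by $f_c(\infty)=\infty$; $\overline{B}(c,r)=\{c'\in\mathbb{C}:|c'-c|\le r\}$. $G_\mu$ is the semigroup under composition generated by $\{f_{c'}:c'\in\operatorname{supp}\mu\}$, and $G_{c,r}$ the one generated by $\{f_{c'}:c'\in\overline{B}(c,r)\}$. $\mathbb{P}_\mu$ is the infinite product of $\mu$ on $\Omega_\mu=\prod_{n\ge1}\operatorname{supp}\mu$. For $\omega=(c_n)$, $f^{(n)}_\omega=f_{c_n}\circ\cdots\circ f_{c_1}$ and $J_\omega=\{z\in\mathbb{C}:\{f^{(n)}_\omega\}_n$ is not normal on any neighborhood of $z\}$. A minimal set of a polynomial semigroup $G$ is a minimal element, with respect to inclusion, of the family of non-empty compact $L\subset\widehat{\mathbb{C}}$ with $g(L)\subset L$ for all $g\in G$; it is planar if $\infty\notin L$. The bifurcation radius $r_{\mathrm{bif}}(c)$ is the supremum of those $r\ge0$ for which $G_{c,r}$ has a planar minimal set (equivalently the infimum of those $r\ge0$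 for which $G_{c,r}$ has no planar minimal set); by prior work this value is attained and $G_{c,r}$ has a planar minimal set iff $r\le r_{\mathrm{bif}}(c)$. *)

(* Defs.v *)
From HB Require Import structures.
From mathcomp Require Import all_boot all_order all_algebra.
From mathcomp Require Import all_classical all_reals all_analysis.
From mathcomp.real_closed Require Import complex.
Import Order.TTheory GRing.Theory Num.Theory.
Import numFieldTopology.Exports numFieldNormedType.Exports.

Set Implicit Arguments.
Unset Strict Implicit.
Unset Printing Implicit Defensive.

Local Open Scope classical_set_scope.
Local Open Scope ring_scope.

Section Defs.
Variable R : realType.

(** The complex plane C = R[i], with the topology induced by its modulus
    (the alias ^o carries the norm topology of the numeric field R[i]). *)
Definition C := (R[i])^o.

Definition cabs (z : C) : R := Normc.normc (z : R[i]).

Definition Chat := one_point_compactification C.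
Definition infty : Chat := None.

Definition fc (c z : C) : C := z ^+ 2 + c.
Definition fhat (c : C) (x : Chat) : Chat :=
  match x with Some z => Some (fc c z) | None => None end.

Definition cball (c : C) (r : R) : set C := [set c' | cabs (c' - c) <= r].

Inductive in_semigroup (S : set C) : (Chat -> Chat) -> Prop :=
| sg_gen c : S c -> in_semigroup S (fhat c)
| sg_comp g h : in_semigroup S g -> in_semigroup S h -> in_semigroup S (g \o h).

Definition invariant_compact (S : set C) (L : set Chat) : Prop :=
  L !=set0 /\ compact L /\ (forall g, in_semigroup S g -> g @` L `<=` L).

Definition minimal_set (S : set C) (L : set Chat) : Prop :=
  invariant_compact S L /\
  (forall L', invariant_compact S L' -> L' `<=` L -> L' = L).

Definition planar (L : set Chat) : Prop := ~ L infty.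

Definition has_planar_minimal_set (S : set C) : Prop :=
  exists L, minimal_set S L /\ planar L.

Definition r_bif (c : C) : R :=
  sup [set r : R | 0 <= r /\ has_planar_minimal_set (cball c r)].

Definition Cborel := g_sigma_algebraType (@open C).

Definition supp (mu : set Cborel -> \bar R) : set C :=
  [set z : C | forall e : R, 0 < e ->
     let D : set Cborel := [set w : C | cabs (w - z) < e] in (0 < mu D)%E].

Definition cyl (n : nat) (A : nat -> set C) : set (nat -> C) :=
  [set w | forall i, (i < n)%N -> A i (w i)].

Definition cylinders : set (set (nat -> C)) :=
  [set B | exists n (A : nat -> set C),
      (forall i, measurable (A i : set Cborel)) /\ B = cyl n A].

Definition Omega := g_sigma_algebraType cylinders.

Definition is_product_measure (mu : set Cborel -> \bar R)
    (P : set Omega -> \bar R) : Prop :=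
  forall n (A : nat -> set C), (forall i, measurable (A i : set Cborel)) ->
    P (cyl n A : set Omega) = (\prod_(i < n) mu (A i : set Cborel))%E.

(** f^{(n)}_w = f_{c_n} o ... o f_{c_1}, where w = (c_1, c_2, ...) and
    c_{k+1} = w k. *)
Fixpoint fiter (w : nat -> C) (n : nat) (z : C) : C :=
  match n with 0 => z | n'.+1 => fc (w n') (fiter w n' z) end.

Definition chordal (x y : Chat) : R :=
  match x, y with
  | Some z, Some w =>
      2 * cabs (z - w) / Num.sqrt ((1 + cabs z ^+ 2) * (1 + cabs w ^+ 2))
  | Some z, None | None, Some z => 2 / Num.sqrt (1 + cabs z ^+ 2)
  | None, None => 0
  end.

Definition normal_on (F : nat -> C -> Chat) (U : set C) : Prop :=
  forall phi : nat -> nat,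
  exists psi : nat -> nat, (forall k, (psi k < psi k.+1)%N) /\
  exists g : C -> Chat,
    forall K : set C, compact K -> K `<=` U ->
    forall e : R, 0 < e -> exists N : nat, forall k, (N <= k)%N ->
      forall z, K z -> chordal (F (phi (psi k)) z) (g z) < e.

Definition julia (w : nat -> C) : set C :=
  [set z : C | forall U : set C, open U -> U z ->
     ~ normal_on (fun n x => Some (fiter w n.+1 x)) U].

End Defs.

(* Main.v *)
(** If [r > r_bif c], no bounded set is invariant under all [f_c'] with [c'] in the closed disk of
    radius [r] about [c]; hence every point is driven to infinity by some word in [supp mu], and by
    compactness by one of finitely many open sets of words, of probability at least [p > 0] and
    length at most [N]. By independence a point survives [k] steps with probability at most
    [(1 - p) ^ (k / N)]. Summing over the time at which the critical point [0] is started, one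
    finds almost surely an [m] and infinitely many times [n] such that all critical orbits started
    before time [n] have escaped at time [n + m]. At such a time [f^(n)] is injective on a
    neighbourhood of every connected set [X] of survivors, because a lemniscate that avoids the
    critical value carries a branch of the square root. If [X] has two points, a Bloch-type
    argument for the inverse branch of [f^(n)] yields a disk, of radius independent of [n], that
    survives up to time [n + m]; in the limit a whole disk would survive, although almost surely
    all rational points escape. So the set of survivors, which contains the Julia set, is totally
    disconnected.

    All function theory is replaced by the maximum principle for quotients of polynomials and by
    the identity [f^(n) z - f^(n) v = (z - v) * \prod_(j < n) (f^(j) z + f^(j) v)].

    The first part holds because the bifurcation radius is attained: a limit of invariant sets for
    radii increasing to [r_bif c] is invariant for the closed disk of radius [r_bif c]. *)

Require Import Defs.
From HB Require Import structures.
From mathcomp Require Import all_boot all_order all_algebra.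
From mathcomp Require Import all_classical all_reals all_analysis.
From mathcomp.real_closed Require Import complex.
From mathcomp Require Import ring lra zify.
Import Order.TTheory GRing.Theory Num.Theory.
Import numFieldTopology.Exports numFieldNormedType.Exports.
Local Open Scope classical_set_scope.
Local Open Scope ring_scope.

Set Implicit Arguments.
Unset Strict Implicit.
Unset Printing Implicit Defensive.

(** * The plane *)

Section Plane.
Variable R : realType.
Implicit Types (z w : C R) (U : set (C R)).

Lemma cabsE z : `|z : R[i]| = (cabs z)%:C%C.
Proof. by case: z. Qed.

Lemma cabs_ge0 z : 0 <= cabs z.
Proof. by case: z => a b; exact: sqrtr_ge0. Qed.

Lemma cabs0 : cabs (0 : C R) = 0.
Proof. exact: Normc.normc0. Qed.

Lemma cabs1 : cabs (1 : C R) = 1.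
Proof. exact: Normc.normc1. Qed.

Lemma cabs_eq0 z : (cabs z == 0) = (z == 0).
Proof.
by apply/eqP/eqP => [/Normc.eq0_normc //|->]; exact: cabs0.
Qed.

Lemma cabs_gt0 z : (0 < cabs z) = (z != 0).
Proof. by rewrite lt_def cabs_eq0 cabs_ge0 andbT. Qed.

Lemma cabsM z w : cabs (z * w) = cabs z * cabs w.
Proof. exact: Normc.normcM. Qed.

Lemma cabsV z : cabs (z^-1) = (cabs z)^-1.
Proof. exact: Normc.normcV. Qed.

Lemma cabsX z n : cabs (z ^+ n) = cabs z ^+ n.
Proof. by elim: n => [|n IH]; rewrite ?expr0 ?cabs1 // !exprS cabsM IH. Qed.

Lemma cabsN z : cabs (- z) = cabs z.
Proof. exact: normcN. Qed.

Lemma cabsD z w : cabs (z + w) <= cabs z + cabs w.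
Proof. exact: le_normcD. Qed.

Lemma cabsC z w : cabs (z - w) = cabs (w - z).
Proof. by rewrite -cabsN opprB. Qed.

Lemma cabs_real (a : R) : cabs (a%:C%C : C R) = `|a|.
Proof. by rewrite /cabs /= expr0n addr0 sqrtr_sqr. Qed.

Lemma cabs2 : cabs (2 : C R) = 2.
Proof. by rewrite -[2 in LHS](rmorph_nat (real_complex R)) cabs_real ger0_norm. Qed.

Lemma cabs_dist z1 z2 z3 : cabs (z1 - z3) <= cabs (z1 - z2) + cabs (z2 - z3).
Proof. by rewrite (_ : z1 - z3 = (z1 - z2) + (z2 - z3)) ?cabsD //; ring. Qed.

Lemma cabsB_ge z w : cabs z - cabs w <= cabs (z - w).
Proof. by rewrite lerBlDr (_ : cabs z = cabs ((z - w) + w)) ?cabsD // subrK. Qed.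

Lemma exists_sqrt z : exists w, w ^+ 2 = z.
Proof. by exists (sqrtc z); exact: sqr_sqrtc. Qed.

(** Radii of balls in [C R] are elements of [R[i]]; being positive they are real, which gives access
    to the real modulus [cabs]. *)
Lemma nbhs_cabs z U :
  nbhs z U <-> exists2 e : R, 0 < e & forall w, cabs (w - z) < e -> U w.
Proof.
split.
  move=> /nbhs_ballP[e e0 He].
  have eE : e = (complex.Re e)%:C%C by apply/esym/RRe_real/gtr0_real.
  exists (complex.Re e); first by move: e0; rewrite eE /= ltcR.
  move=> w wz; apply: He; rewrite /ball /= cabsE eE ltcR cabsC //.
move=> [e e0 He]; apply/nbhs_ballP; exists (e%:C%C); first by rewrite /= ltcR.
by move=> w /=; rewrite /ball /= cabsE ltcR cabsC; exact: He.
Qed.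

Lemma open_cabs U :
  open U <-> forall z, U z -> exists2 e : R, 0 < e & forall w, cabs (w - z) < e -> U w.
Proof.
by rewrite openE; split => H z /H /nbhs_cabs.
Qed.

Lemma open_disk z (e : R) : open [set w : C R | cabs (w - z) < e].
Proof.
apply/open_cabs => w /= wz; exists (e - cabs (w - z)); first by rewrite subr_gt0.
by move=> v vw; apply: le_lt_trans (cabs_dist v w z) _; rewrite -ltrBrDr.
Qed.

Lemma continuous_cabs : continuous (@cabs R).
Proof.
move=> z V /nbhs_ballP[e /= e0 He]; rewrite /fmap /=.
apply/nbhs_cabs; exists e => // w wz; apply: He; rewrite /ball /=; apply: le_lt_trans wz.
have := cabsB_ge w z; have := cabsB_ge z w; rewrite (cabsC z w) ler_norml.
by move=> h1 h2; apply/andP; split; lra.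
Qed.

Lemma cabs_le_coord z w :
  cabs (z - w) <= `|complex.Re z - complex.Re w| + `|complex.Im z - complex.Im w|.
Proof.
have -> : z - w = ((complex.Re z - complex.Re w)%:C%C : C R) +
    (((complex.Im z - complex.Im w) *i)%C : C R).
  apply/eqP; rewrite eq_complex; case: z => a b; case: w => c d /=.
  by rewrite addr0 add0r !eqxx.
apply: le_trans (cabsD _ _) _; rewrite cabs_real lerD2l.
by rewrite /cabs /= expr0n add0r sqrtr_sqr.
Qed.

Lemma hausdorff_plane : hausdorff_space (C R).
Proof. exact: norm_hausdorff. Qed.

Lemma compact_square (M : R) :
  compact [set z : C R | `|complex.Re z| <= M /\ `|complex.Im z| <= M].
Proof.
pose g (p : R * R) : C R := (p.1 +i* p.2)%C.
have gc : continuous g.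
  move=> [a b] V /nbhs_ballP[e /= e0 He].
  have eE : e = (complex.Re e)%:C%C by apply/esym/RRe_real/gtr0_real.
  have e1 : 0 < complex.Re e by move: e0; rewrite eE /= ltcR.
  exists (ball a (complex.Re e / 2), ball b (complex.Re e / 2)).
    by split; apply: nbhsx_ballx; rewrite divr_gt0.
  move=> [c d] [/= ca db]; apply: He; rewrite /ball /= cabsE eE ltcR.
  apply: le_lt_trans (cabs_le_coord _ _) _.
  by rewrite [complex.Re e]splitr; apply: ltrD.
have -> : [set z : C R | `|complex.Re z| <= M /\ `|complex.Im z| <= M] = g @` (`[-M, M] `*` `[-M, M]).
  apply/seteqP; split => [z /= [aM bM]|z [[a b] /= + <-]].
    by exists (complex.Re z, complex.Im z); [rewrite /= !in_itv /= -!ler_norml|case: z {aM bM}].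
  by rewrite !in_itv /= -!ler_norml.
apply: continuous_compact; first exact: continuous_subspaceT.
by apply: compact_setX; exact: segment_compact.
Qed.

Lemma cabs_Re z : `|complex.Re z| <= cabs z.
Proof.
case: z => a b /=; rewrite -sqrtr_sqr; apply: ler_wsqrtr.
by rewrite lerDl sqr_ge0.
Qed.

Lemma cabs_Im z : `|complex.Im z| <= cabs z.
Proof.
case: z => a b /=; rewrite -sqrtr_sqr; apply: ler_wsqrtr.
by rewrite lerDr sqr_ge0.
Qed.

Lemma bounded_closed_compact_plane (M : R) U :
  closed U -> (forall z, U z -> cabs z <= M) -> compact U.
Proof.
move=> cU bU; apply: (subclosed_compact cU (@compact_square M)) => z /bU zM.
by split; [exact: le_trans (cabs_Re z) zM|exact: le_trans (cabs_Im z) zM].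
Qed.

Lemma compact_bounded_plane U : compact U -> exists M : R, forall z, U z -> cabs z <= M.
Proof.
move=> cU; have [U0|U0] := pselect (U !=set0); last first.
  by exists 0 => z Uz; case: U0; exists z.
have [c _ H] := @compact_EVT_max _ R _ _ U0 cU (continuous_subspaceT continuous_cabs).
by exists (cabs c) => z Uz; apply: H; rewrite inE.
Qed.

End Plane.

(** * Maximum principle *)

Section MaximumPrinciple.
Variable R : realType.
Implicit Types (z w : C R) (A B S : {poly C R}).

Lemma near_lt (f g : C R -> R) z : {for z, continuous f} -> {for z, continuous g} ->
  f z < g z -> exists2 e : R, 0 < e & forall w, cabs (w - z) < e -> f w < g w.
Proof.
move=> cf cg fg; apply/nbhs_cabs.
have h : (fun w => g w - f w) @ z --> g z - f z by exact: (continuousB cg cf).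
have n0 : nbhs (g z - f z) [set x : R | 0 < x].
  by apply: open_nbhs_nbhs; split; [exact: open_gt|rewrite /= subr_gt0].
have H := h _ n0; move: H; rewrite /fmap /= => H.
apply: (@filterS _ _ (nbhs_filter z) _ _ _ H) => w /=; by rewrite subr_gt0.
Qed.

Lemma continuous_horner_plane A : continuous (fun z : C R => A.[z]).
Proof.
elim/poly_ind: A => [|A c IH] z.
  under eq_fun do rewrite horner0.
  exact: cst_continuous.
under eq_fun do rewrite hornerMXaddC.
apply: (@continuousD _ (C R) (C R) (fun z => A.[z] * z) (fun=> c)); last exact: cst_continuous.
by apply: (@continuousM (C R) (C R) (fun z => A.[z]) id) => //; exact: IH.
Qed.

Lemma continuous_cabs_horner A : continuous (fun z : C R => cabs A.[z]).
Proof.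
move=> z; apply: (@continuous_comp _ _ _ (fun z => A.[z]) (@cabs R)).
  exact: continuous_horner_plane.
exact: continuous_cabs.
Qed.

Lemma closed_le_fun (T : topologicalType) (f g : T -> R) :
  continuous f -> continuous g -> closed [set x | f x <= g x].
Proof.
move=> cf cg.
have -> : [set x | f x <= g x] = (fun x => g x - f x) @^-1` [set y | 0 <= y].
  by apply/seteqP; split => x /=; rewrite subr_ge0.
apply: preimage_closed; last exact: closed_ge.
by move=> x _; apply: cvgB; [exact: cg|exact: cf].
Qed.

(** The open mapping argument for [A / B]: with [a], [b] the values at [z0],
    [A b - B a = S * (z - z0) ^+ k] where [S] has a nonzero value [s] at [z0]. Along a direction [v]
    with [v ^+ k = a b / s] the quotient grows like [1 + rho ^+ k]. *)
Lemma local_growth A B z0 : B.[z0] != 0 -> A.[z0] != 0 ->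
  A * (B.[z0])%:P - B * (A.[z0])%:P != 0 ->
  forall e : R, 0 < e -> exists2 z, cabs (z - z0) < e &
    cabs A.[z0] * cabs B.[z] < cabs A.[z] * cabs B.[z0].
Proof.
set a := A.[z0]; set b := B.[z0] => b0 a0 T0 e e0.
have [k [S]] := multiplicity_XsubC (A * b%:P - B * a%:P) z0.
rewrite T0 /= => rS TE.
set s := S.[z0]; have s0 : s != 0 by [].
have Tz z : A.[z] * b = a * B.[z] + S.[z] * (z - z0) ^+ k.
  have := congr1 (fun p => p.[z]) TE.
  rewrite !hornerE => <-; ring.
have k0 : (0 < k)%N.
  rewrite lt0n; apply/eqP => k0; move: (Tz z0).
  rewrite k0 expr0 mulr1 -/a -/b -/s => h.
  by move/eqP: s0; apply; apply: (addrI (a * b)); rewrite -h addr0.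
have [v vk] : exists v : C R, v ^+ k = a * b / s.
  have [v vE] := @solve_monicpoly (C R) k (fun i => if i == 0%N then a * b / s else 0) k0.
  exists v; rewrite {}vE; case: k k0 {TE Tz} => // k _.
  by rewrite big_ord_recl /= expr0 mulr1 big1 ?addr0 // => i _; rewrite mul0r.
have v0 : v != 0.
  by apply/eqP => v0; move/eqP: vk; rewrite v0 expr0n eqn0Ngt k0 /= eq_sym !mulf_eq0 invr_eq0
    (negbTE a0) (negbTE b0) (negbTE s0).
(* Near [z0] the ratio [S b / (B s)] is within 1/2 of 1, so the error term is less than half of the
   gain [rho ^+ k]. *)
have [d d0 Hd] : exists2 d : R, 0 < d & forall w, cabs (w - z0) < d ->
    cabs (B * s%:P - S * b%:P).[w] < cabs (B * (s / 2)%:P).[w].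
  apply: near_lt; [exact: continuous_cabs_horner|exact: continuous_cabs_horner|].
  rewrite !hornerE -/s -/b (mulrC s b) subrr cabs0 cabs_gt0.
  by rewrite !mulf_neq0 // invr_eq0 pnatr_eq0.
pose rho := Num.min d e / (2 * cabs v).
have cv : 0 < cabs v by rewrite cabs_gt0.
have rho0 : 0 < rho by rewrite divr_gt0 ?lt_min ?d0 ?e0 // mulr_gt0.
pose z : C R := z0 + (rho%:C%C : C R) * v.
have zz : cabs (z - z0) < Num.min d e.
  rewrite /z addrAC subrr add0r cabsM cabs_real gtr0_norm // /rho invfM mulrA divfK ?gt_eqF //.
  by rewrite gtr_pMr ?lt_min ?d0 //; lra.
move: zz; rewrite lt_min => /andP[zd ze].
exists z => //; have := Hd _ zd; rewrite !hornerE.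
set u := B.[z]; set t := S.[z] => Hu.
have := Tz z; rewrite -/u -/t {3}/z addrAC subrr add0r exprMn vk => TT.
have r0 : 0 < rho ^+ k by rewrite exprn_gt0.
rewrite -(cabsM A.[z]) TT.
have -> : a * u + t * ((rho%:C%C : C R) ^+ k * (a * b / s)) =
   (a / s) * ((u * s) * (1 + (rho%:C%C : C R) ^+ k) - (rho%:C%C : C R) ^+ k * (u * s - t * b)).
  by field.
rewrite -cabsM (_ : a * u = (a / s) * (u * s)); last by field.
rewrite !(cabsM (a / s)) ltr_pM2l; last by rewrite cabs_gt0 mulf_neq0 // invr_eq0.
apply: lt_le_trans (cabsB_ge _ _).
rewrite !(cabsM (u * s)) (cabsM (_ ^+ k)) cabsX cabs_real gtr0_norm //.
have -> : cabs (1 + (rho%:C%C : C R) ^+ k) = 1 + rho ^+ k.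
  by rewrite -[1 in LHS](rmorph1 (real_complex R)) -rmorphXn -rmorphD cabs_real gtr0_norm // addr_gt0.
have h2 : cabs (u * s / 2) = cabs (u * s) / 2.
  by rewrite cabsM cabsV cabs2.
move: Hu; rewrite ?mulrA h2 => Hu.
have : rho ^+ k * cabs (u * s - t * b) < rho ^+ k * (cabs (u * s) / 2) by rewrite ltr_pM2l.
have := cabs_ge0 (u * s - t * b).
nra.
Qed.

(** The points of [T] outside [O] play the role of the boundary. For a positive maximum of the
    modulus of [A / B] on [T], take a maximum point with greatest real part. It cannot lie in [O]:
    either [local_growth] gives a larger value nearby, or the quotient is constant and a small step
    to the right gives another maximum point. *)
Lemma maximum_principle (T O : set (C R)) A B (M : R) :
  compact T -> open O -> O `<=` T -> 0 <= M -> (forall z, T z -> B.[z] != 0) ->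
  (forall z, T z -> ~ O z -> cabs A.[z] <= M * cabs B.[z]) ->
  forall z, T z -> cabs A.[z] <= M * cabs B.[z].
Proof.
move=> cT oO OT M0 B0 bd z Tz.
pose f z := cabs A.[z] / cabs B.[z].
have cf : {within T, continuous f}.
  apply: continuous_in_subspaceT => w; rewrite inE => Tw.
  apply: (@continuousM R (C R) (fun z => cabs A.[z]) (fun z => (cabs B.[z])^-1)).
    exact: continuous_cabs_horner.
  by apply: (@continuousV R (C R) (fun z => cabs B.[z])); [rewrite cabs_eq0 B0|exact: continuous_cabs_horner].
have [z1 + Hm] := @compact_EVT_max _ R f T (ex_intro _ z Tz) cT cf.
rewrite inE => Tz1; set m := f z1 in Hm.
have HA w : T w -> cabs A.[w] <= m * cabs B.[w].
  move=> Tw; have := Hm w; rewrite inE => /(_ Tw).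
  by rewrite /f ler_pdivrMr // cabs_gt0 B0.
suff mM : m <= M.
  by apply: le_trans (HA _ Tz) _; rewrite ler_wpM2r ?cabs_ge0.
pose T' := T `&` [set w | m * cabs B.[w] <= cabs A.[w]].
have cT' : compact T'.
  apply: compact_closedI => //; apply: closed_le_fun; last exact: continuous_cabs_horner.
  by move=> w; apply: (@continuousM R (C R) (fun=> m) (fun z => cabs B.[z])); [exact: cst_continuous|exact: continuous_cabs_horner].
have T'z1 : T' z1 by split => //=; rewrite /m /f divfK // cabs_eq0 B0.
have cRe : continuous (fun z : C R => complex.Re z).
  move=> w V /nbhs_ballP[e /= e0 He]; rewrite /fmap /=.
  apply/nbhs_cabs; exists e => // v wv; apply: He; rewrite /ball /= distrC.
  by apply: le_lt_trans wv; apply: le_trans (cabs_Re _); case: (v); case: (w).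
have [z0] := @compact_EVT_max _ R _ _ (ex_intro _ z1 T'z1) cT' (continuous_subspaceT cRe).
rewrite inE => -[Tz0 mz0] zmax.
have mE : cabs A.[z0] = m * cabs B.[z0] by apply/le_anti; rewrite HA.
have bz0 : 0 < cabs B.[z0] by rewrite cabs_gt0 B0.
have [Oz0|nO] := pselect (O z0); last first.
  by have := bd _ Tz0 nO; rewrite mE ler_pM2r.
have [->//|m0] := eqVneq m 0.
have mp : 0 < m by rewrite lt_def m0 divr_ge0 ?cabs_ge0.
have a0 : A.[z0] != 0 by rewrite -cabs_gt0 mE mulr_gt0.
have [e e0 He] := (open_cabs _).1 oO _ Oz0.
have [P0|P0] := eqVneq (A * (B.[z0])%:P - B * (A.[z0])%:P) 0; last first.
  have [w we] := local_growth (B0 _ Tz0) a0 P0 e0.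
  rewrite mE mulrAC ltr_pM2r // => lt1.
  by have := HA _ (OT _ (He _ we)); rewrite leNgt lt1.
pose w : C R := z0 + ((e / 2)%:C%C : C R).
have wz : cabs (w - z0) < e.
  by rewrite /w addrAC subrr add0r cabs_real gtr0_norm ?divr_gt0 //; lra.
have T'w : T' w.
  split; first exact/OT/He.
  have := congr1 (fun p => cabs p.[w]) P0.
  rewrite !hornerE cabs0 => /eqP; rewrite cabs_eq0 subr_eq0 => /eqP /(congr1 (@cabs R)).
  by rewrite !cabsM mE mulrA (mulrC _ m) => /(mulIf (lt0r_neq0 bz0)) /= ->.
have := zmax w; rewrite inE => /(_ T'w).
by rewrite /w; case: (z0) => x y /=; lra.
Qed.

End MaximumPrinciple.

(** * Square roots on lemniscates *)

Section Splitting.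
Variable R : realType.
Implicit Types (y z s : C R) (L Y : set (C R)).

(* A continuous branch of the square root of [s - s0] on [L], encoded by its range [Y]. *)
Definition sqrt_branch L s0 Y :=
  [/\ compact Y, (forall y, L (y ^+ 2 + s0) <-> Y y \/ Y (- y)) &
      forall y, Y y -> ~ Y (- y)].

(** A point equidistant from [y'] and [- y'] is at distance at least [cabs y'] from both, while
    [y ^+ 2 - y' ^+ 2] is the product of [y - y'] and [y + y']. *)
Lemma closer_or_opposite y y' : cabs (y ^+ 2 - y' ^+ 2) < cabs y' ^+ 2 ->
  cabs (y - y') != cabs (y + y').
Proof.
move=> h; apply/eqP => E; move: h.
rewrite subr_sqr cabsM -E ltNge -expr2 => /negP; apply.
rewrite ler_pXn2r ?nnegrE ?cabs_ge0 //.
have := cabsD (y + y') (y' - y); rewrite (_ : y + y' + (y' - y) = 2 * y'); last by ring.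
rewrite cabsM cabs2 (cabsC y') -E; lra.
Qed.

Lemma continuous_sqr : continuous (fun y : C R => y ^+ 2).
Proof. by move=> y; apply: (@continuousM (C R) (C R) id id). Qed.

Lemma compact_preim_fc L s : compact L -> compact [set y : C R | L (y ^+ 2 + s)].
Proof.
move=> cL; have [M LM] := compact_bounded_plane cL.
apply: (@bounded_closed_compact_plane _ (1 + M + cabs s)).
  have cl : closed L by apply: compact_closed => //; exact: hausdorff_plane.
  apply: (@preimage_closed _ _ (fun y : C R => y ^+ 2 + s) L) => // y _.
  apply: (@continuousD _ (C R) (C R) (fun y => y ^+ 2) (fun=> s)); last exact: cst_continuous.
  exact: continuous_sqr.
move=> y /= /LM h.
have h2 : cabs y ^+ 2 <= M + cabs s.
  rewrite -cabsX (_ : y ^+ 2 = y ^+ 2 + s - s); last by ring.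
  apply: le_trans (cabsD _ _) _; rewrite cabsN; lra.
have := cabs_ge0 y; have := cabs_ge0 s; nra.
Qed.

(** The relation [r] is a reference function from [L] to the compact set [Y0], given by a closed
    graph in place of continuity. The branch consists of those roots that are closer to the
    reference value than their opposites; [closer_or_opposite] excludes ties. *)
Lemma sqrt_branch_from L s0 Y0 (r : C R -> set (C R)) :
  compact L -> compact Y0 ->
  (forall y, L (y ^+ 2 + s0) -> exists2 y', Y0 y' & r (y ^+ 2 + s0) y') ->
  (forall s y y', L s -> Y0 y -> Y0 y' -> r s y -> r s y' -> y = y') ->
  closed [set p : C R * C R | r (p.1 ^+ 2 + s0) p.2] ->
  (forall y y', L (y ^+ 2 + s0) -> Y0 y' -> r (y ^+ 2 + s0) y' ->
    cabs (y ^+ 2 - y' ^+ 2) < cabs y' ^+ 2) ->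
  exists Y, sqrt_branch L s0 Y.
Proof.
move=> cL cY0 ex uniq clr lt.
pose P := ([set y : C R | L (y ^+ 2 + s0)] `*` Y0) `&`
  ([set p : C R * C R | r (p.1 ^+ 2 + s0) p.2] `&`
   [set p : C R * C R | cabs (p.1 - p.2) <= cabs (p.1 + p.2)]).
have cP : compact P.
  apply: compact_closedI; first by apply: compact_setX => //; exact: compact_preim_fc.
  apply: closedI => //; apply: closed_le_fun => p.
    apply: (@continuous_comp _ _ _ (fun p : C R * C R => p.1 - p.2) (@cabs R)).
      by apply: (@continuousB _ (C R) _ fst snd); [exact: cvg_fst|exact: cvg_snd].
    exact: continuous_cabs.
  apply: (@continuous_comp _ _ _ (fun p : C R * C R => p.1 + p.2) (@cabs R)).
    by apply: (@continuousD _ (C R) _ fst snd); [exact: cvg_fst|exact: cvg_snd].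
  exact: continuous_cabs.
exists (fst @` P); split.
- apply: continuous_compact => //; apply: continuous_subspaceT => p; exact: cvg_fst.
- move=> y; split.
    move=> Ly; have [y' Yy' ry'] := ex _ Ly.
    have [le1|lt1] := leP (cabs (y - y')) (cabs (y + y')).
      by left; exists (y, y').
    right; exists (- y, y') => //; split; first by split => //=; rewrite sqrrN.
    by split; rewrite /= ?sqrrN // (_ : - y - y' = - (y + y')) ?cabsN ?(addrC (- y)) 1?cabsC ?ltW //; ring.
  by case=> -[[a b] [[/= h _] _] E]; move: h; rewrite E ?sqrrN.
- move=> y [[a b] [[/= La Yb] [/= rb le1]] E] [[a' b'] [[/= La' Yb'] [/= rb' le2]] E'].
  move: La rb le1 La' rb' le2; rewrite {a}E {a'}E' sqrrN => La rb le1 _ rb' le2.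
  have bb : b' = b by exact: (uniq _ _ _ La).
  have := closer_or_opposite (lt _ _ La Yb rb); rewrite eq_le le1 /= => /negP; apply.
  move: le2; rewrite bb (_ : - y - b = - (y + b)) ?cabsN; last by ring.
  by rewrite (addrC (- y)) (cabsC b).
Qed.

(** A constant reference [y0] with [y0 ^+ 2 = - s0] serves: if [y ^+ 2 = s - s0], then
    [y ^+ 2 - y0 ^+ 2 = s]. *)
Lemma sqrt_branch_far L s0 : compact L -> (forall s, L s -> cabs s < cabs s0) ->
  exists Y, sqrt_branch L s0 Y.
Proof.
move=> cL far; have [y0 y0E] := exists_sqrt (- s0).
apply: (@sqrt_branch_from L s0 [set y0] (fun _ _ => True)) => //.
- exact: compact_set1.
- by move=> y _; exists y0.
- by move=> s y y' _ -> ->.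
- move=> y y' Ly -> _; rewrite -cabsX y0E opprK cabsN; exact: far.
Qed.

(** The branch for [s0] is the reference for [s1]: the squares of root and reference differ by
    [s0 - s1], which is smaller than the squared reference [s - s0]. *)
Lemma sqrt_branch_move L s0 s1 : compact L -> (exists Y, sqrt_branch L s0 Y) ->
  (forall s, L s -> cabs (s1 - s0) < cabs (s - s0)) -> exists Y, sqrt_branch L s1 Y.
Proof.
move=> cL [Y [cY YL Yo]] near.
(* The equation [y' ^+ 2 = s - s0] is written as an inequality so that [closed_le_fun] gives its
   closedness. *)
apply: (@sqrt_branch_from L s1 Y (fun s y' => cabs (y' ^+ 2 + s0 - s) <= 0)) => //.
- move=> y Ly; have [y' y'E] := exists_sqrt (y ^+ 2 + s1 - s0).
  have : L (y' ^+ 2 + s0) by rewrite y'E subrK.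
  move=> /YL[Yy'|Yy']; [exists y'|exists (- y')] => //; rewrite ?sqrrN y'E; 
  by rewrite subrK subrr cabs0.
- move=> s y y' Ls Yy Yy'; rewrite !le_eqVlt !ltNge !cabs_ge0 !orbF !cabs_eq0 !subr_eq0.
  move=> /eqP <- /eqP /addIr /eqP; rewrite eq_sym eqf_sqr => /orP[/eqP //|/eqP E].
  by case: (Yo _ Yy'); rewrite -E.
- apply: closed_le_fun; last exact: cst_continuous.
  move=> p; apply: (@continuous_comp _ _ _
    (fun p : C R * C R => p.2 ^+ 2 + s0 - (p.1 ^+ 2 + s1)) (@cabs R)); last exact: continuous_cabs.
  apply: (@continuousB _ (C R) _ (fun p : C R * C R => p.2 ^+ 2 + s0) (fun p : C R * C R => p.1 ^+ 2 + s1)).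
    apply: (@continuousD _ (C R) _ (fun p : C R * C R => p.2 ^+ 2) (fun=> s0)); last exact: cst_continuous.
    by apply: (@continuous_comp _ _ _ snd (fun y : C R => y ^+ 2)); [exact: cvg_snd|exact: continuous_sqr].
  apply: (@continuousD _ (C R) _ (fun p : C R * C R => p.1 ^+ 2) (fun=> s1)); last exact: cst_continuous.
  by apply: (@continuous_comp _ _ _ fst (fun y : C R => y ^+ 2)); [exact: cvg_fst|exact: continuous_sqr].
- move=> y y' Ly Yy'; rewrite !le_eqVlt !ltNge !cabs_ge0 !orbF !cabs_eq0 !subr_eq0 => /eqP E.
  have d : y ^+ 2 - y' ^+ 2 = s0 - s1.
    by apply/eqP; rewrite subr_eq addrAC eq_sym subr_eq addrC E.
  by have := near _ Ly; rewrite -E addrK cabsX (cabsC s1) d ltNge.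
Qed.

(* A lemniscate is polynomially convex, so every point outside it can be moved to
   infinity without crossing it, and the branch of the square root is dragged along. *)
Lemma sqrt_branch_lemniscate (P : {poly C R}) (rho : R) c :
  0 <= rho -> compact [set z : C R | cabs P.[z] <= rho] -> rho < cabs P.[c] ->
  exists Y, sqrt_branch [set z : C R | cabs P.[z] <= rho] c Y.
Proof.
set L := [set z | _] => rho0 cL cP.
have clL : closed L by apply: compact_closed => //; exact: hausdorff_plane.
pose good s := exists Y, sqrt_branch L s Y.
have step s : ~ L s -> exists2 e : R, 0 < e & forall s', cabs (s' - s) < e ->
    ~ L s' /\ (good s' <-> good s).
  move=> nLs; have : open (~` L) by exact: closed_openC.
  (* No point of [L] is closer to [s] than [e]; within half of it the branch can be moved from [s]
     to [s'] and also back. *)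
  move=> /open_cabs /(_ s nLs) [e e0 He]; exists (e / 2); first by rewrite divr_gt0.
  have far t : L t -> e <= cabs (t - s) by move=> Lt; rewrite leNgt; apply/negP => /He.
  move=> s' s's; split; first by apply: He; lra.
  split=> g; apply: (sqrt_branch_move cL g) => t Lt; have := far _ Lt; rewrite ?(cabsC s s').
    by have := cabs_dist t s' s; lra.
  by lra.
have [M LM] := compact_bounded_plane cL.
apply: contrapT => ngc.
(* If [c] had no branch it would belong to [O], which is open and bounded with boundary in [L]; the
   maximum principle would then give [cabs P.[c] <= rho]. *)
pose O := [set s | ~ L s /\ ~ good s].
have oO : open O.
  apply/open_cabs => s [nL ng]; have [e e0 He] := step _ nL; exists e => // s' /He[? gg].
  by split=> // /gg.
have cT : compact (L `|` O).
  apply: (@bounded_closed_compact_plane _ (`|M| + 1)).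
    rewrite -openC; apply/open_cabs => s /= nLO.
    have nL : ~ L s by move=> Ls; apply: nLO; left.
    have gs : good s by apply: contrapT => ng; apply: nLO; right.
    have [e e0 He] := step _ nL; exists e => // s' /He[nL' gg] [//|[_ ng]].
    by apply: ng; apply/gg.
  move=> s; rewrite leNgt => -[/LM h|[nL ng]]; apply/negP => lt1.
    by have := ler_norm M; lra.
  by apply: ng; apply: sqrt_branch_far => // t /LM; have := ler_norm M; lra.
have Oc : O c by split=> //; rewrite /L /= leNgt cP.
have : cabs P.[c] <= rho * cabs (1 : {poly C R}).[c].
  apply: (maximum_principle cT oO) => //; last by right.
  - by move=> z _; rewrite hornerC oner_neq0.
  - by move=> z [Lz _|//]; rewrite hornerC cabs1 mulr1.
by rewrite hornerC cabs1 mulr1 leNgt cP.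
Qed.

End Splitting.

(** * Bloch disks *)

Section Bloch.
Variable R : realType.
Implicit Types (z w u v : C R).

(** Connectedness of the segment from [z0] to [z]: its part in [O] is both relatively open and
    relatively closed. *)
Lemma disk_subset_clopen (O : set (C R)) z0 (r : R) :
  open O -> O z0 ->
  (forall z, cabs (z - z0) < r -> closure O z -> O z) ->
  forall z, cabs (z - z0) < r -> O z.
Proof.
move=> oO Oz0 clO z zr.
pose g (t : R) : C R := z0 + (t%:C%C : C R) * (z - z0).
have gd t s : cabs (g t - g s) = `|t - s| * cabs (z - z0).
  by rewrite -cabs_real -cabsM /g; congr cabs; rewrite rmorphB /=; ring.
have gc : continuous g.
  move=> t V /nbhs_cabs[e e0 He]; apply/nbhs_ballP.
  have c1 : 0 < cabs (z - z0) + 1 by have := cabs_ge0 (z - z0); lra.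
  exists (e / (cabs (z - z0) + 1)); first by rewrite /= divr_gt0.
  move=> s; rewrite /ball /= ltr_pdivlMr // => st; apply: He; rewrite gd distrC.
  by have := normr_ge0 (t - s); nra.
have gr t : t \in `[0, 1] -> cabs (g t - z0) < r.
  rewrite in_itv /= => /andP[t0 t1]; rewrite /g addrAC subrr add0r cabsM cabs_real ger0_norm //.
  by have := cabs_ge0 (z - z0); nra.
have g1 : g 1 = z by rewrite /g rmorph1 mul1r addrC subrK.
have g0 : g 0 = z0 by rewrite /g rmorph0 mul0r addr0.
have conn : connected `[(0 : R), 1] by exact: segment_connected.
pose B := `[(0 : R), 1] `&` (g @^-1` O).
have BE : B = `[(0 : R), 1]%classic.
  apply: conn.
  - by exists 0; split; rewrite /= ?in_itv /= ?lexx ?ler01 // g0.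
  - by exists (g @^-1` O) => //; apply: open_comp => // t _; exact: gc.
  - exists (g @^-1` closure O).
      by apply: preimage_closed; [move=> t _; exact: gc|exact: closed_closure].
    apply/seteqP; split => t [t01 /= Ot]; split => //; first exact: subset_closure.
    by apply: clO => //; exact: gr.
rewrite -g1; suff: B 1 by case.
by rewrite BE /= in_itv /= ler01 lexx.
Qed.

(* [H w] is the difference quotient [(Q z - Q w) / (z - w)] as a polynomial in [z]. *)
Lemma bloch_disk (Z : set (C R)) (Q : {poly C R}) (H : C R -> {poly C R})
    u1 (delta : R) x y (d : R) :
  compact Z ->
  (forall z w, Q.[z] - Q.[w] = (z - w) * (H w).[z]) ->
  continuous (fun p : C R * C R => cabs (H p.2).[p.1]) ->
  (forall z w, Z z -> Z w -> (H w).[z] != 0) ->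
  0 < delta -> 0 < d ->
  (forall u, cabs (u - u1) <= delta -> exists2 z, Z z & Q.[z] = u) ->
  (forall z, Z z -> cabs (Q.[z] - u1) < delta ->
    exists2 e : R, 0 < e & forall v, cabs (v - z) < e -> Z v) ->
  Z x -> Z y -> Q.[x] = u1 -> cabs (Q.[y] - u1) <= delta / 8 -> d <= cabs (x - y) ->
  exists2 z0, Z z0 & forall z, cabs (z - z0) < 7 * d / 24 -> Z z.
Proof.
move=> cZ QH cH H0 dl0 d0 sur opn Zx Zy Qx Qy dxy.
have clZ : closed Z by apply: compact_closed => //; exact: hausdorff_plane.
pose rad z := cabs (Q.[z] - u1).
have crad : continuous rad.
  have -> : rad = fun z => cabs (Q - u1%:P).[z] by apply/funext => z; rewrite /rad !hornerE.
  exact: continuous_cabs_horner.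
(* The quotient weighted by the distance of the images to the boundary of the disk has a
   maximum, as in the usual proof of Bloch's theorem. *)
pose T := Z `&` [set z | rad z <= delta].
have cT : compact T.
  by apply: compact_closedI => //; apply: closed_le_fun => //; exact: cst_continuous.
pose W (p : C R * C R) := delta - Num.max (rad p.1) (rad p.2).
have cW : continuous W.
  move=> p; apply: (@continuousB _ R _ (fun=> delta) (fun p : C R * C R => Num.max (rad p.1) (rad p.2))).
    exact: cst_continuous.
  apply: (@continuous_max _ _ (fun p : C R * C R => rad p.1) (fun p : C R * C R => rad p.2)).
    by apply: (@continuous_comp _ _ _ fst rad); [exact: cvg_fst|exact: crad].
  by apply: (@continuous_comp _ _ _ snd rad); [exact: cvg_snd|exact: crad].
pose F (p : C R * C R) := W p / cabs (H p.2).[p.1].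
have cF : {within T `*` T, continuous F}.
  apply: continuous_in_subspaceT => p; rewrite inE => -[[Zp1 _] [Zp2 _]].
  apply: (@continuousM R _ W (fun p => (cabs (H p.2).[p.1])^-1)); first exact: cW.
  by apply: (@continuousV R _ (fun p => cabs (H p.2).[p.1])); [rewrite cabs_eq0 H0|exact: cH].
have Tx : T x by split => //=; rewrite /rad Qx subrr cabs0 ltW.
have Ty : T y by split => //=; rewrite /rad; lra.
have [p0 + pmax] := @compact_EVT_max _ R F (T `*` T) (ex_intro _ (y, x) (conj Ty Tx))
  (compact_setX cT cT) cF.
rewrite inE => Tp0; set a := F p0 in pmax.
have Wa z w : T z -> T w -> W (z, w) <= a * cabs (H w).[z].
  move=> Tz Tw; have := pmax (z, w); rewrite inE => /(_ (conj Tz Tw)).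
  by rewrite /F /= ler_pdivrMr // cabs_gt0 H0 //; [case: Tz|case: Tw].
(* The pair [(y, x)] has weight at least [7 / 8 * delta], and the difference quotient there is at
   most [delta / (8 * d)]. *)
have a7 : 7 * d <= a.
  have h := Wa _ _ Ty Tx.
  have W7 : 7 / 8 * delta <= W (y, x).
    rewrite /W /= {2}/rad Qx subrr cabs0 lerBrDl -lerBrDr ge_max.
    by apply/andP; split; rewrite /rad; lra.
  have := congr1 (@cabs R) (QH y x); rewrite cabsM Qx => E.
  have yx : d <= cabs (y - x) by rewrite cabsC.
  have := cabs_ge0 (H x).[y] => Hge.
  have Hp : 0 < cabs (H x).[y] by rewrite cabs_gt0 H0.
  have h8 : 8 * d * cabs (H x).[y] <= delta by nra.
  rewrite -(ler_pM2r Hp); lra.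
have a0 : 0 < a by lra.
pose T2 := (T `*` T) `&` [set p | a * cabs (H p.2).[p.1] <= W p].
have cT2 : compact T2.
  apply: compact_closedI; first exact: compact_setX.
  apply: closed_le_fun => // p.
  by apply: (@continuousM R _ (fun=> a) (fun p => cabs (H p.2).[p.1])); [exact: cst_continuous|exact: cH].
have T2p0 : T2 p0.
  split=> //=; rewrite /a /F divfK // cabs_eq0.
  by case: Tp0 => -[? _] [? _]; exact: H0.
have cgap : continuous (fun p : C R * C R => cabs (Q.[p.1] - Q.[p.2])).
  move=> p; apply: (@continuous_comp _ _ _ (fun p : C R * C R => Q.[p.1] - Q.[p.2]) (@cabs R));
    last exact: continuous_cabs.
  apply: (@continuousB _ (C R) _ (fun p : C R * C R => Q.[p.1]) (fun p : C R * C R => Q.[p.2])).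
    by apply: (@continuous_comp _ _ _ fst (fun z => Q.[z])); [exact: cvg_fst|exact: continuous_horner_plane].
  by apply: (@continuous_comp _ _ _ snd (fun z => Q.[z])); [exact: cvg_snd|exact: continuous_horner_plane].
(* Among the maximal pairs take one with the closest images: halving the segment between
   the images would give a closer maximal pair, so the pair is diagonal. *)
have [[z w]] := compact_EVT_min (ex_intro _ p0 T2p0) cT2 (continuous_subspaceT cgap).
rewrite inE => -[[/= [Zz rz] [Zw rw]] /= mzw] pmin.
have [z0 [Zz0 rz0 mz0]] : exists z0, [/\ Z z0, rad z0 <= delta & a * cabs (H z0).[z0] <= delta - rad z0].
  have [E|/eqP Ne] := eqVneq Q.[z] Q.[w].
    have /eqP := QH z w; rewrite E subrr eq_sym mulf_eq0 (negbTE (H0 _ _ Zz Zw)) orbF subr_eq0.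
    move=> /eqP zw; exists w; split=> //.
    by move: mzw; rewrite zw /W /= maxxx.
  exfalso; pose u := (Q.[z] + Q.[w]) / 2.
  have radu : cabs (u - u1) <= Num.max (rad z) (rad w).
    have -> : u - u1 = ((Q.[z] - u1) + (Q.[w] - u1)) / 2 by rewrite /u; field.
    rewrite cabsM cabsV cabs2 ler_pdivrMr //.
    apply: le_trans (cabsD _ _) _; rewrite -/(rad z) -/(rad w).
    have : rad z <= Num.max (rad z) (rad w) by rewrite le_max lexx.
    have : rad w <= Num.max (rad z) (rad w) by rewrite le_max lexx orbT.
    lra.
  have [v Zv Qv] : exists2 v, Z v & Q.[v] = u.
    by apply: sur; apply: le_trans radu _; rewrite ge_max rz rw.
  have rv : rad v <= Num.max (rad z) (rad w) by rewrite /rad Qv.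
  have Tz : T z by []. have Tw : T w by [].
  have Tv : T v by split=> //=; apply: le_trans rv _; rewrite ge_max rz rw.
  pose D := cabs (Q.[z] - Q.[w]).
  have D0 : 0 < D by rewrite cabs_gt0 subr_eq0; apply/eqP.
  have Dzv : cabs (Q.[z] - Q.[v]) = D / 2.
    by rewrite Qv (_ : _ - u = (Q.[z] - Q.[w]) / 2) ?cabsM ?cabsV ?cabs2 // /u; field.
  have Dvw : cabs (Q.[v] - Q.[w]) = D / 2.
    by rewrite Qv (_ : u - _ = (Q.[z] - Q.[w]) / 2) ?cabsM ?cabsV ?cabs2 // /u; field.
  have W1 : W (z, w) <= W (z, v).
    by rewrite /W /= lerD2l lerN2 ge_max rv le_max lexx.
  have W2 : W (z, w) <= W (v, w).
    by rewrite /W /= lerD2l lerN2 ge_max rv le_max lexx orbT.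
  have n1 : cabs (H w).[z] < cabs (H v).[z].
    rewrite -(ltr_pM2l a0) ltNge; apply/negP => h.
    have := pmin (z, v); rewrite inE /= => /(_ _).
    rewrite Dzv -/D => hh; have : D <= D / 2 by apply: hh; split => //=; lra.
    lra.
  have n2 : cabs (H w).[z] < cabs (H w).[v].
    rewrite -(ltr_pM2l a0) ltNge; apply/negP => h.
    have := pmin (v, w); rewrite inE /= => /(_ _).
    rewrite Dvw -/D => hh; have : D <= D / 2 by apply: hh; split => //=; lra.
    lra.
  have := congr1 (@cabs R) (QH z w); have := congr1 (@cabs R) (QH z v).
  have := congr1 (@cabs R) (QH v w); rewrite !cabsM Dzv Dvw -/D.
  have := cabs_dist z v w.
  have := cabs_ge0 (z - v); have := cabs_ge0 (v - w); have := cabs_ge0 (z - w).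
  have Hp : 0 < cabs (H w).[z] by rewrite cabs_gt0 H0.
  move=> g1 g2 g3 tri e1 e2 e3.
  (* Since [D = cabs (z - w) * cabs (H w).[z]], both [z - v] and [v - w] come out shorter than half
     of [z - w], against the triangle inequality. *)
  have k1 : cabs (H w).[z] * cabs (z - v) < D / 2.
    rewrite e2 mulrC ltr_pM2l //; rewrite lt_def g3 andbT; apply/eqP => h0.
    by move: e2; rewrite h0 mul0r; lra.
  have k2 : cabs (H w).[z] * cabs (v - w) < D / 2.
    rewrite e1 mulrC ltr_pM2l //; rewrite lt_def g2 andbT; apply/eqP => h0.
    by move: e1; rewrite h0 mul0r; lra.
  nra.
have h0p : 0 < cabs (H z0).[z0] by rewrite cabs_gt0 H0.
(* Half the distance from [Q.[z0]] to the boundary of the disk. Over the disk of radius [t] about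
   [Q.[z0]] the weights stay at least [t], so [H1] is at least [t / a] in modulus, hence at least
   half of [h0]. *)
pose t := (delta - rad z0) / 2.
have t0 : 0 < t by rewrite divr_gt0 //; nra.
pose u0 := Q.[z0]; pose H1 := H z0; pose h0 := H1.[z0].
have QH1 z' : cabs (Q.[z'] - u0) = cabs (z' - z0) * cabs H1.[z'] by rewrite /u0 QH cabsM.
have H1c z' : Z z' -> 0 < cabs H1.[z'] by move=> Zz'; rewrite cabs_gt0 H0.
have crel : continuous (fun z => cabs (Q.[z] - u0)).
  have -> : (fun z => cabs (Q.[z] - u0)) = fun z => cabs (Q - u0%:P).[z].
    by apply/funext => z'; rewrite !hornerE.
  exact: continuous_cabs_horner.
have radt z' : cabs (Q.[z'] - u0) <= t -> rad z' <= delta - t.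
  move=> h; have := cabs_dist Q.[z'] u0 u1; rewrite -/(rad z') -/(rad z0) /t.
  by move: h; rewrite /t; lra.
have low z' : Z z' -> cabs (Q.[z'] - u0) <= t -> t <= a * cabs H1.[z'].
  move=> Zz' h; have rz' := radt _ h.
  have := Wa z' z0; rewrite /W /= => /(_ _ _) hh.
  apply: le_trans (hh _ _); last 2 first.
  - by split => //=; lra.
  - by split.
  by rewrite lerBrDl -lerBrDr ge_max; apply/andP; split; rewrite /t in rz' *; lra.
have up : a * cabs h0 <= 2 * t by rewrite /t /h0 /H1; lra.
have [G GE] : exists G, H1 - h0%:P = G * ('X - z0%:P).
  have /factor_theorem[G ->] : root (H1 - h0%:P) z0 by rewrite /root !hornerE subrr.
  by exists G.
have GH z' : cabs (H1.[z'] - h0) = cabs G.[z'] * cabs (z' - z0).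
  by have := congr1 (fun p => cabs p.[z']) GE; rewrite !hornerE cabsM.
have opnt (r : R) : r <= t -> open [set z' | Z z' /\ cabs (Q.[z'] - u0) < r].
  move=> rt; apply/open_cabs => z' [Zz' h].
  have [|e1 e10 He1] := opn _ Zz'; first by have := radt z'; rewrite -/(rad z'); lra.
  have [|e2 e20 He2] := @near_lt _ (fun z => cabs (Q.[z] - u0)) (fun=> r) z' (crel z') _ h.
    exact: cst_continuous.
  exists (Num.min e1 e2); first by rewrite lt_min e10.
  by move=> v; rewrite lt_min => /andP[v1 v2]; split; [exact: He1|exact: He2].
have clt (r : R) : closed (Z `&` [set z' | cabs (Q.[z'] - u0) <= r]).
  by apply: closedI => //; apply: closed_le_fun => //; exact: cst_continuous.
(* [G / H1 ^+ 2] is, up to a constant, the quotient of [1 / H1 - 1 / h0] by [Q - u0]. *)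
have Gbd z' : Z z' -> cabs (Q.[z'] - u0) <= t -> cabs G.[z'] <= 3 / t * cabs (H1 ^+ 2).[z'].
  move=> Zz' h.
  apply: (@maximum_principle _ (Z `&` [set z' | cabs (Q.[z'] - u0) <= t])
    [set z' | Z z' /\ cabs (Q.[z'] - u0) < t]) => //.
  - by apply: compact_closedI => //; apply: closed_le_fun => //; exact: cst_continuous.
  - exact: opnt.
  - by move=> v [Zv /ltW].
  - by rewrite divr_ge0 // ltW.
  - by move=> v [Zv _]; rewrite horner_exp expf_neq0 // -cabs_gt0 H1c.
  (* On the level [t] one has [cabs (H1 - h0) <= 3 * cabs H1] and [cabs (v - z0) * cabs H1 = t],
     whence the constant [3 / t]. *)
  move=> v [Zv /= vt] nv.
  have vE : cabs (Q.[v] - u0) = t.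
    by apply/eqP; rewrite eq_le vt leNgt; apply/negP => h'; apply: nv.
  have lv := low _ Zv vt; have pv := H1c _ Zv.
  have := GH v; have := QH1 v; rewrite vE => e1 e2.
  have := cabsD H1.[v] (- h0); rewrite cabsN e2 => e3.
  have vz : 0 < cabs (v - z0).
    by rewrite lt_def cabs_ge0 andbT; apply/eqP => h'; move: e1; rewrite h' mul0r; lra.
  have h3 : cabs h0 <= 2 * cabs H1.[v] by rewrite -(ler_pM2l a0); lra.
  rewrite horner_exp cabsX -(ler_pM2r vz) (_ : _ * _ * _ = 3 / t * (cabs (v - z0) * cabs H1.[v]) * cabs H1.[v]).
    by rewrite -e1 divfK ?lt0r_neq0 //; lra.
  by ring.
(* On the level [t / 6] the bound on [G] makes [H1 - h0] at most half of [H1] in modulus. So [H1] is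
   at most [4 * t / a], and dividing [t / 6] by it gives [a / 24], which is at least
   [7 * d / 24]. *)
have far z' : Z z' -> cabs (Q.[z'] - u0) = t / 6 -> a / 24 <= cabs (z' - z0).
  move=> Zz' E; have zt : cabs (Q.[z'] - u0) <= t by lra.
  have := Gbd _ Zz' zt; rewrite horner_exp cabsX => g1.
  have := QH1 z'; rewrite E => e1; have pv := H1c _ Zz'.
  have e2 := GH z'.
  have e3 : cabs (H1.[z'] - h0) <= cabs H1.[z'] / 2.
    rewrite e2; apply: (@le_trans _ _ (3 / t * cabs H1.[z'] ^+ 2 * cabs (z' - z0))).
      by rewrite ler_wpM2r ?cabs_ge0.
    rewrite (_ : _ * _ * _ = 3 / t * (cabs (z' - z0) * cabs H1.[z']) * cabs H1.[z']); last by ring.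
    rewrite -e1 (_ : 3 / t * (t / 6) = 1 / 2); last by field; rewrite lt0r_neq0.
    by lra.
  have := cabsB_ge H1.[z'] h0 => e4.
  have e5 : cabs H1.[z'] <= 2 * cabs h0 by lra.
  have e6 : a * cabs H1.[z'] <= 4 * t.
    have : a * cabs H1.[z'] <= a * (2 * cabs h0) by rewrite ler_pM2l.
    by lra.
  rewrite -(ler_pM2r pv) -e1; lra.
exists z0 => // z' zz'.
have [] // : [set z' | Z z' /\ cabs (Q.[z'] - u0) < t / 6] z'.
apply: (@disk_subset_clopen _ z0 (7 * d / 24)) => //.
- by apply: opnt; lra.
- by split => //; rewrite subrr cabs0; lra.
move=> v vr cv.
have : (Z `&` [set z' | cabs (Q.[z'] - u0) <= t / 6]) v.
  by apply: (clt (t / 6)); apply: closureS cv => q [Zq /ltW].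
move=> [Zv /=]; rewrite le_eqVlt => /orP[/eqP E|//].
by have := far _ Zv E; lra.
Qed.

End Bloch.

(** * Orbits *)

Section Orbits.
Variable R : realType.
Implicit Types (w : nat -> C R) (z u v : C R) (X : set (C R)).

(** Orbits restarted at time [j]: critical orbits have to be followed from every starting time. *)
Definition orb w j k z := fiter (fun i => w (j + i)%N) k z.

Lemma orbS w j k z : orb w j k.+1 z = orb w j k z ^+ 2 + w (j + k)%N.
Proof. by []. Qed.

Lemma fiter_orb w n z : fiter w n z = orb w 0 n z.
Proof. by []. Qed.

Lemma orb_add w j k l z : orb w j (k + l) z = orb w (j + k) l (orb w j k z).
Proof. by elim: l => [|l IH]; rewrite ?addn0 // addnS !orbS IH addnA. Qed.

Lemma orb_recl w j k z : orb w j k.+1 z = orb w j.+1 k (z ^+ 2 + w j).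
Proof. by rewrite -add1n orb_add addn1 orbS addn0. Qed.

Fixpoint orb_poly w j k : {poly C R} :=
  if k is k'.+1 then orb_poly w j k' ^+ 2 + (w (j + k')%N)%:P else 'X.

Lemma horner_orb_poly w j k z : (orb_poly w j k).[z] = orb w j k z.
Proof. by elim: k => [|k IH]; rewrite /= !hornerE // IH. Qed.

Lemma continuous_orb w j k : continuous (orb w j k).
Proof.
have -> : orb w j k = fun z => (orb_poly w j k).[z].
  by apply/funext => z; rewrite horner_orb_poly.
exact: continuous_horner_plane.
Qed.

Lemma continuous_cabs_orb w j k : continuous (fun z => cabs (orb w j k z)).
Proof.
move=> z; apply: (@continuous_comp _ _ _ (orb w j k) (@cabs R)).
  exact: continuous_orb.
exact: continuous_cabs.
Qed.

(** The difference quotient of [f^(n)] at [v], obtained by factoring [x ^+ 2 - y ^+ 2] at every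
    step. It vanishes exactly where the two orbits become opposite before time [n]. *)
Definition orb_quotient w n v : {poly C R} :=
  \prod_(j < n) (orb_poly w 0 j + (orb w 0 j v)%:P).

Lemma horner_orb_quotient w n v z :
  (orb_quotient w n v).[z] = \prod_(j < n) (orb w 0 j z + orb w 0 j v).
Proof.
rewrite horner_prod; apply: eq_bigr => j _.
by rewrite hornerD hornerC horner_orb_poly.
Qed.

Lemma orb_quotientE w n z v :
  (orb_poly w 0 n).[z] - (orb_poly w 0 n).[v] = (z - v) * (orb_quotient w n v).[z].
Proof.
rewrite !horner_orb_poly horner_orb_quotient.
elim: n => [|n IH]; first by rewrite big_ord0 mulr1.
by rewrite big_ord_recr /= mulrA -IH !orbS; ring.
Qed.

Lemma continuous_orb_quotient w n :
  continuous (fun p : C R * C R => cabs (orb_quotient w n p.2).[p.1]).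
Proof.
pose P k (p : C R * C R) := \prod_(j < k) (orb w 0 j p.1 + orb w 0 j p.2).
have -> : (fun p : C R * C R => cabs (orb_quotient w n p.2).[p.1]) = (@cabs R) \o P n.
  by apply/funext => p; rewrite /= horner_orb_quotient.
have cP : continuous (P n).
  elim: n => [|n IH].
    rewrite (_ : P 0%N = fun=> 1); last by apply/funext => p; rewrite /P big_ord0.
    exact: cst_continuous.
  rewrite (_ : P n.+1 = fun p => P n p * (orb w 0 n p.1 + orb w 0 n p.2)); last first.
    by apply/funext => p; rewrite /P big_ord_recr.
  move=> p; apply: (@continuousM (C R) _ (P n) (fun p : C R * C R => orb w 0 n p.1 + orb w 0 n p.2)).
    exact: IH.
  apply: (@continuousD _ (C R) _ (fun p : C R * C R => orb w 0 n p.1) (fun p : C R * C R => orb w 0 n p.2)).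
    by apply: (@continuous_comp _ _ _ fst (orb w 0 n)); [exact: cvg_fst|exact: continuous_orb].
  by apply: (@continuous_comp _ _ _ snd (orb w 0 n)); [exact: cvg_snd|exact: continuous_orb].
by move=> p; apply: continuous_comp; [exact: cP|exact: continuous_cabs].
Qed.

Lemma plane_net (r eta : R) : 0 < eta ->
  exists s : seq (C R), forall u, cabs u <= r -> exists2 c, c \in s & cabs (u - c) < eta.
Proof.
move=> eta0.
have cD : compact [set u : C R | cabs u <= r].
  apply: (@bounded_closed_compact_plane _ r) => //.
  by apply: closed_le_fun; [exact: continuous_cabs|exact: cst_continuous].
have := cD; rewrite compact_cover => /(_ (C R) setT (fun c => [set u | cabs (u - c) < eta])).
case=> [c _|u _|D' _ H]; first exact: open_disk.
  by exists u => //=; rewrite subrr cabs0.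
exists (finmap.enum_fset D') => u /H[c cD' uc]; by exists c.
Qed.

(* Pigeonhole on [N + 1] points of [X] whose distances to [a] are equally spaced. *)
Lemma connected_pigeonhole (r eta : R) : 0 < eta ->
  exists N : nat, forall X (g : C R -> C R) a b, connected X -> X a -> X b ->
    (forall x, X x -> cabs (g x) <= r) ->
    exists x y, [/\ X x, X y, cabs (a - b) / N.+1%:R <= cabs (x - y) & cabs (g x - g y) <= eta].
Proof.
move=> eta0; have [|s Hs] := @plane_net r (eta / 2); first by rewrite divr_gt0.
exists (size s) => X g a b cX Xa Xb gr.
pose d := cabs (a - b).
have d0 : 0 <= d by exact: cabs_ge0.
have [E|dn0] := eqVneq d 0.
  exists a, a; rewrite !subrr cabs0; split => //; last exact: ltW.
  by rewrite -/d E mul0r.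
have dp : 0 < d by rewrite lt_def dn0.
(* A connected set containing [a] and [b] meets every circle about [a] of radius at most
   [cabs (a - b)]. *)
have lvl (v : R) : 0 <= v -> v <= d -> exists2 x, X x & cabs (x - a) = v.
  move=> v0 vd; apply: contrapT => H.
  have nE x : X x -> cabs (x - a) != v by move=> Xx; apply/eqP => E; apply: H; exists x.
  have vp : 0 < v by rewrite lt_def v0 andbT eq_sym -(cabs0 R) -(subrr a) nE.
  have vlt : v < d by rewrite lt_def vd andbT /d cabsC nE.
  pose B := X `&` [set x | cabs (x - a) < v].
  have BX : B = X.
    apply: cX.
    - by exists a; split => //=; rewrite subrr cabs0.
    - by exists [set x | cabs (x - a) < v] => //; exact: open_disk.
    - exists [set x | cabs (x - a) <= v].
        apply: closed_le_fun; last exact: cst_continuous.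
        have -> : (fun x : C R => cabs (x - a)) = fun x => cabs ('X - a%:P).[x].
          by apply/funext => x; rewrite !hornerE.
        exact: continuous_cabs_horner.
      apply/seteqP; split => x [Xx /= xv]; split => //=; first exact: ltW.
      by rewrite lt_def xv andbT eq_sym nE.
  have : B b by rewrite BX.
  by case=> _ /=; rewrite cabsC -/d ltNge ltW.
have ex (i : 'I_(size s).+1) : exists p : C R * C R,
    [/\ X p.1, cabs (p.1 - a) = i%:R * (d / (size s).+1%:R), p.2 \in s & cabs (g p.1 - p.2) < eta / 2].
  have [||x Xx xE] := lvl (i%:R * (d / (size s).+1%:R)).
  - by rewrite mulr_ge0 // divr_ge0.
  - rewrite mulrA ler_pdivrMr ?ltr0Sn // mulrC ler_wpM2l // ler_nat ltnW //.
  - by have [c cs xc] := Hs _ (gr _ Xx); exists (x, c).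
pose p i := projT1 (cid (ex i)).
have pP i : [/\ X (p i).1, cabs ((p i).1 - a) = i%:R * (d / (size s).+1%:R),
   (p i).2 \in s & cabs (g (p i).1 - (p i).2) < eta / 2] by exact: (projT2 (cid (ex i))).
have [i [j [ij pij]]] : exists i j : 'I_(size s).+1, (i < j)%N /\ (p i).2 = (p j).2.
  apply: contrapT => H.
  have inj : injective (fun i => (p i).2).
    move=> i j E; apply: val_inj => /=; case: (ltngtP i j) => // h.
      by case: H; exists i, j.
    by case: H; exists j, i.
  have : (size (map (fun i => (p i).2) (enum 'I_(size s).+1)) <= size s)%N.
    apply: uniq_leq_size; first by rewrite map_inj_uniq ?enum_uniq.
    by move=> c /mapP[i _ ->]; case: (pP i).
  by rewrite size_map size_enum_ord ltnn.
have [Xi Ei _ gi] := pP i; have [Xj Ej _ gj] := pP j.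
exists (p j).1, (p i).1; split => //.
- have := cabs_dist (p j).1 (p i).1 a; rewrite Ei Ej -/d.
  set q := d / _; have q0 : 0 <= q by rewrite divr_ge0.
  have : (i%:R + 1) * q <= j%:R * q by rewrite ler_wpM2r // natr1 ler_nat.
  by lra.
- have := cabs_dist (g (p j).1) (p j).2 (g (p i).1).
  by rewrite -{2}pij (cabsC (p i).2); lra.
Qed.

(** * Escape, good times and univalent pieces for parameters of modulus at most [M] *)

Section Bounded.
Variable M : R.
Hypothesis M1 : 1 <= M.
Local Notation rad := (M + 2).

Lemma escape_step c z : cabs c <= M -> rad < cabs z -> 2 * cabs z <= cabs (z ^+ 2 + c).
Proof.
have hM := M1.
move=> cM zr; have := cabsB_ge (z ^+ 2) (- c); rewrite opprK cabsN cabsX.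
have h1 : (M + 2) * cabs z <= cabs z ^+ 2 by rewrite expr2 ler_wpM2r ?cabs_ge0 // ltW.
have h2 : 0 <= M * (cabs z - 1) by apply: mulr_ge0; lra.
lra.
Qed.

(** A point that survives one more step lies a whole unit inside the escape disk; this margin makes
    survival stable under perturbation. *)
Lemma survive_step c z : cabs c <= M -> cabs (z ^+ 2 + c) <= rad -> cabs z <= rad - 1.
Proof.
have hM := M1.
move=> cM; have := cabsB_ge (z ^+ 2) (- c); rewrite opprK cabsN cabsX => h1 h2.
rewrite -(@ler_pXn2r _ 2) ?nnegrE ?cabs_ge0 //; last by lra.
by rewrite (_ : M + 2 - 1 = M + 1) ?sqrrD; [nra|ring].
Qed.

Lemma escape_orb w j k l z : (forall i, cabs (w i) <= M) -> rad < cabs (orb w j k z) ->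
  2 ^+ l * rad < cabs (orb w j (k + l) z).
Proof.
have hM := M1.
move=> wM h; elim: l => [|l IH]; first by rewrite addn0 expr0 mul1r.
have r0 : 0 < rad by lra.
have h2 : rad < cabs (orb w j (k + l) z).
  by apply: le_lt_trans IH; rewrite ler_peMl ?exprn_ege1 ?ler1n // ltW.
rewrite addnS orbS exprS -mulrA; apply: lt_le_trans (escape_step (wM _) h2).
by rewrite ltr_pM2l.
Qed.

Lemma survive_le w j k l z : (forall i, cabs (w i) <= M) -> (k <= l)%N ->
  cabs (orb w j l z) <= rad -> cabs (orb w j k z) <= rad.
Proof.
have hM := M1.
move=> wM kl; rewrite !leNgt; apply: contra => h.
rewrite -(subnKC kl); have := escape_orb (l - k) wM h; apply: le_lt_trans.
have r0 : 0 < rad by lra.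
by rewrite ler_peMl ?exprn_ege1 ?ler1n // ltW.
Qed.

Lemma compact_survive w j k : (forall i, cabs (w i) <= M) ->
  compact [set z | cabs (orb w j k z) <= rad].
Proof.
move=> wM; apply: (@bounded_closed_compact_plane _ rad).
  by apply: closed_le_fun; [exact: continuous_cabs_orb|exact: cst_continuous].
by move=> z; apply: (@survive_le w j 0 k).
Qed.

(** Survival bounds all intermediate points by [rad], where squaring is Lipschitz; hence [delta] is
    uniform in the parameters, the starting time and the point. *)
Lemma orb_equicontinuous m (eta : R) : 0 < eta ->
  exists2 delta : R, 0 < delta & forall w j x u, (forall i, cabs (w i) <= M) ->
    cabs (orb w j m x) <= rad -> cabs (u - x) <= delta ->
    cabs (orb w j m u - orb w j m x) <= eta.
Proof.
have hM := M1.
elim: m eta => [|m IH] eta eta0; first by exists eta.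
have r0 : 0 < rad by lra.
have e0 : 0 < Num.min 1 (eta / (1 + 2 * rad)) by rewrite lt_min ltr01 divr_gt0 //; lra.
have [delta d0 Hd] := IH _ e0; exists delta => // w j x u wM hx ux.
have hm : cabs (orb w j m x) <= rad by exact: survive_le hx.
have := Hd _ _ _ _ wM hm ux; rewrite le_min ler_pdivlMr; last by lra.
move=> /andP[h1 h2].
rewrite !orbS (_ : _ - _ = (orb w j m u - orb w j m x) * ((orb w j m u - orb w j m x) + 2 * orb w j m x)).
  rewrite cabsM; apply: le_trans h2; rewrite ler_wpM2l ?cabs_ge0 //.
  apply: le_trans (cabsD _ _) _; by rewrite cabsM cabs2; lra.
by ring.
Qed.

(** Surviving step [m.+1] puts the point within [rad - 1] at step [m], and equicontinuity with
    [eta = 1] spends that margin. *)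
Lemma survive_margin m : exists2 delta : R, 0 < delta &
  forall w j x u, (forall i, cabs (w i) <= M) ->
    cabs (orb w j m.+1 x) <= rad -> cabs (u - x) <= delta -> cabs (orb w j m u) <= rad.
Proof.
have [delta d0 Hd] := @orb_equicontinuous m 1 ltr01.
exists delta => // w j x u wM hx ux.
have h1 : cabs (orb w j m x) <= rad by exact: survive_le hx.
have h2 : cabs (orb w j m x) <= rad - 1 by apply: (survive_step (wM (j + m)%N)); rewrite -orbS.
have := Hd _ _ _ _ wM h1 ux; have := cabsB_ge (orb w j m u) (orb w j m x); lra.
Qed.

(** All critical orbits are tested at the same absolute time [n + m]. The delay [m] stays fixed
    while [n] grows. *)
Definition good_time w m n := forall j, (j < n)%N -> rad < cabs (orb w j (n + m - j) 0).

(** The points at time [j.+1] surviving up to [n + m] form a lemniscate avoiding the critical value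
    [w j], so its preimage splits into disjoint closed halves [Y] and [- Y]. The image of the
    connected set [X] lies in one of them, which is the half returned. *)
Lemma level_branch w m n X j : (forall i, cabs (w i) <= M) -> good_time w m n ->
  connected X -> X `<=` [set z | cabs (orb w 0 (n + m) z) <= rad] -> (j < n)%N ->
  exists Y : set (C R), [/\ compact Y,
    (forall y, cabs (orb w j (n + m - j) y) <= rad <-> Y y \/ Y (- y)),
    (forall y, Y y -> ~ Y (- y)) & forall x, X x -> Y (orb w 0 j x)].
Proof.
have hM := M1.
move=> wM gd cX XK jn.
have r0 : 0 <= rad by lra.
have jE : (n + m - j = (n + m - j.+1).+1)%N by lia.
have lem : [set z | cabs (orb_poly w j.+1 (n + m - j.+1)).[z] <= rad] =
  [set z | cabs (orb w j.+1 (n + m - j.+1) z) <= rad].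
  by apply/seteqP; split => z /=; rewrite horner_orb_poly.
have [||Y [cY YL Yo]] := @sqrt_branch_lemniscate R (orb_poly w j.+1 (n + m - j.+1)) rad (w j) r0.
- by rewrite lem; exact: compact_survive.
- by have := gd _ jn; rewrite jE orb_recl expr0n add0r horner_orb_poly.
have YL' y : cabs (orb w j (n + m - j) y) <= rad <-> Y y \/ Y (- y).
  by rewrite -YL lem /= jE orb_recl.
have XY x : X x -> Y (orb w 0 j x) \/ Y (- orb w 0 j x).
  move=> /XK /= h; apply/YL'; move: h.
  by rewrite -{1}(@subnKC j (n + m)) ?orb_add ?add0n //; lia.
have clY : closed Y by apply: compact_closed => //; exact: hausdorff_plane.
have cl1 : closed [set x | Y (orb w 0 j x)].
  by apply: (preimage_closed _ clY) => x _; exact: continuous_orb.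
have cl2 : closed [set x | Y (- orb w 0 j x)].
  apply: (@preimage_closed _ _ (fun x => - orb w 0 j x) Y) => // x _.
  by apply: continuousN; exact: continuous_orb.
have [e|ne] := pselect ((X `&` [set x | Y (orb w 0 j x)]) !=set0); last first.
  exists [set y | Y (- y)]; split.
  - apply: (@subclosed_compact _ _ ((fun y : C R => - y) @` Y)).
    + apply: (@preimage_closed _ _ (fun y : C R => - y) Y) => // y _.
      exact: (@continuousN _ (C R) (C R) id).
    + apply: continuous_compact => //; apply: continuous_subspaceT => y.
      exact: (@continuousN _ (C R) (C R) id).
    + by move=> y Yy; exists (- y) => //; rewrite opprK.
  - by move=> y /=; rewrite YL' opprK or_comm.
  - by move=> y /= Y1; rewrite opprK => Y2; exact: (Yo _ Y2).
  - by move=> x Xx; case: (XY x Xx) => // h; case: ne; exists x.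
have XE : X `&` [set x | Y (orb w 0 j x)] = X.
  apply: cX => //.
  - exists (~` [set x | Y (- orb w 0 j x)]); first exact: closed_openC.
    apply/seteqP; split => x [Xx /= h]; split => //=; first by exact: Yo.
    by case: (XY x Xx).
  - by exists [set x | Y (orb w 0 j x)].
exists Y; split => // x Xx.
have : (X `&` [set x | Y (orb w 0 j x)]) x by rewrite XE.
by case.
Qed.

(** [Z] collects the survivors whose orbit is in the half chosen for [X] at each time before [n].
    Two points of [Z] never have opposite iterates, so [f^(n)] is injective there. [Z] is relatively
    open because the opposite halves are closed, and it covers all points that survive from time [n]
    because roots can be chosen in the right half. *)
Lemma univalent_piece w m n X : (forall i, cabs (w i) <= M) -> good_time w m n ->
  connected X -> X `<=` [set z | cabs (orb w 0 (n + m) z) <= rad] ->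
  exists Z : set (C R), [/\ compact Z, X `<=` Z,
    Z `<=` [set z | cabs (orb w 0 (n + m) z) <= rad] &
    [/\ forall z v j, Z z -> Z v -> (j < n)%N -> orb w 0 j z + orb w 0 j v != 0,
      forall z, Z z -> exists2 e : R, 0 < e & forall v, cabs (v - z) < e ->
        cabs (orb w 0 (n + m) v) <= rad -> Z v &
      forall u, cabs (orb w n m u) <= rad -> exists2 z, Z z & orb w 0 n z = u]].
Proof.
move=> wM gd cX XK.
have exY j : exists Y : set (C R), (j < n)%N -> [/\ compact Y,
    (forall y, cabs (orb w j (n + m - j) y) <= rad <-> Y y \/ Y (- y)),
    (forall y, Y y -> ~ Y (- y)) & forall x, X x -> Y (orb w 0 j x)].
  have [jn|nj] := boolP (j < n)%N; last by exists set0.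
  by have [Y HY] := level_branch wM gd cX XK jn; exists Y.
pose Y j := projT1 (cid (exY j)).
have YP j (jn : (j < n)%N) := projT2 (cid (exY j)) jn; rewrite -/(Y _) in YP.
have clY j : (j < n)%N -> closed (Y j).
  by move=> /YP[? _ _ _]; apply: compact_closed => //; exact: hausdorff_plane.
pose Z := [set z | cabs (orb w 0 (n + m) z) <= rad] `&`
  \bigcap_(j in [set j | (j < n)%N]) [set z | Y j (orb w 0 j z)].
have orbK j v : (j < n)%N -> cabs (orb w 0 (n + m) v) <= rad ->
    Y j (orb w 0 j v) \/ Y j (- orb w 0 j v).
  move=> jn h; have [_ YL _ _] := YP _ jn; apply/YL; move: h.
  by rewrite -{1}(@subnKC j (n + m)) ?orb_add ?add0n //; lia.
exists Z; split; [|by move=> x Xx; split; [exact: XK|move=> j /YP[_ _ _]; exact]|by move=> z []|split].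
- apply: compact_closedI; first exact: compact_survive.
  apply: closed_bigI => j jn; apply: (preimage_closed _ (clY _ jn)) => x _.
  exact: continuous_orb.
- move=> z v j [_ Zz] [_ Zv] jn; apply/eqP => E.
  have [_ _ Yo _] := YP _ jn; apply: (Yo _ (Zz _ jn)).
  by have := Zv _ jn; rewrite /= (_ : - _ = orb w 0 j v) //; apply/eqP; rewrite eq_sym -addr_eq0 addrC E.
- move=> z [_ Zz].
  have loc k : (k <= n)%N -> exists2 e : R, 0 < e & forall v, cabs (v - z) < e ->
      cabs (orb w 0 (n + m) v) <= rad -> forall j, (j < k)%N -> Y j (orb w 0 j v).
    elim: k => [_|k IH kn]; first by exists 1.
    have [e e0 He] := IH (ltnW kn).
    have : open (~` [set v | Y k (- orb w 0 k v)]).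
      apply: closed_openC; apply: (@preimage_closed _ _ (fun x => - orb w 0 k x) (Y k)); last exact: clY.
      by move=> x _; apply: continuousN; exact: continuous_orb.
    have [_ _ Yo _] := YP _ kn.
    move=> /open_cabs /(_ z) [|e' e'0 He']; first exact/Yo/Zz.
    exists (Num.min e e'); first by rewrite lt_min e0.
    move=> v; rewrite lt_min => /andP[v1 v2] vK j; rewrite ltnS leq_eqVlt => /orP[/eqP ->|]; last exact: He.
    by case: (orbK _ _ kn vK) => // /He'; case.
  have [e e0 He] := loc n (leqnn n); exists e => // v ve vK; split => //.
  by move=> j jn; exact: He.
- move=> u uK.
  (* Pulling [u] back from time [n] to time [n - k], one root at a time. *)
  have lift k : (k <= n)%N -> exists y, orb w (n - k) k y = u /\
     forall i, (i < k)%N -> Y (n - k + i)%N (orb w (n - k) i y).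
    elim: k => [_|k IH kn]; first by exists u.
    have [y [yu yY]] := IH (ltnW kn).
    have nk : (n - k = (n - k.+1).+1)%N by lia.
    have [y' y'E] := exists_sqrt (y - w (n - k.+1)%N).
    have st y'' : y'' ^+ 2 = y - w (n - k.+1)%N -> orb w (n - k.+1) k.+1 y'' = u.
      by move=> E; rewrite orb_recl E subrK -nk.
    have jn : (n - k.+1 < n)%N by lia.
    have [_ YL _ _] := YP _ jn.
    have : cabs (orb w (n - k.+1) (n + m - (n - k.+1)) y') <= rad.
      rewrite (_ : (n + m - (n - k.+1))%N = (k.+1 + m)%N); last by lia.
      by rewrite orb_add st // (_ : (n - k.+1 + k.+1)%N = n) //; lia.
    move=> /YL Yy'.
    have [y'' y''E Yy''] : exists2 y'', y'' ^+ 2 = y - w (n - k.+1)%N & Y (n - k.+1)%N y''.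
      by case: Yy' => h; [exists y'|exists (- y')]; rewrite ?sqrrN.
    exists y''; split; first exact: st.
    case=> [_|i ik]; first by rewrite addn0.
    by rewrite orb_recl y''E subrK -nk addnS -addSn -nk; exact: yY.
  have [z [zu zY]] := lift n (leqnn n); rewrite subnn in zu zY.
  exists z => //; split => /=; first by rewrite orb_add zu add0n.
  by move=> j jn /=; have := zY _ jn; rewrite add0n.
Qed.

(** [bloch_disk] for [f^(n)] on the univalent piece. The disk of radius [delta] about the image of
    [x] survives [m] more steps since [x] survives [m.+1]. The radius obtained depends on [d] alone,
    not on [n]. *)
Lemma surviving_disk w m n X (delta d : R) x y : (forall i, cabs (w i) <= M) -> good_time w m n ->
  connected X -> (forall z k, X z -> cabs (orb w 0 k z) <= rad) ->
  0 < delta -> 0 < d ->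
  (forall w j x u, (forall i, cabs (w i) <= M) ->
    cabs (orb w j m.+1 x) <= rad -> cabs (u - x) <= delta -> cabs (orb w j m u) <= rad) ->
  X x -> X y -> d <= cabs (x - y) -> cabs (orb w 0 n x - orb w 0 n y) <= delta / 8 ->
  exists2 z0, cabs z0 <= rad &
    forall z, cabs (z - z0) < 7 * d / 24 -> cabs (orb w 0 (n + m) z) <= rad.
Proof.
move=> wM gd cX XK dl0 d0 marg Xx Xy dxy nxy.
have [Z [cZ XZ ZK [Zs Zo Zl]]] := univalent_piece wM gd cX (fun z Xz => XK z (n + m)%N Xz).
have inK u : cabs (u - orb w 0 n x) <= delta -> cabs (orb w n m u) <= rad.
  move=> h; apply: marg h => //.
  by have := XK _ (n + m.+1)%N Xx; rewrite orb_add add0n.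
have [||||||z0 Zz0 H] := @bloch_disk R Z (orb_poly w 0 n) (orb_quotient w n) (orb w 0 n x) delta x y d
  cZ (orb_quotientE w n) (@continuous_orb_quotient w n) _ dl0 d0 _ _ (XZ _ Xx) (XZ _ Xy).
- move=> z v Zz Zv; rewrite horner_orb_quotient; apply/prodf_neq0 => j _; exact: Zs.
- by move=> u /inK /Zl[z Zz zu]; exists z => //; rewrite horner_orb_poly.
- move=> z Zz; rewrite horner_orb_poly => h.
  have [e e0 He] := Zo _ Zz.
  have [|||e' e'0 He'] := @near_lt R (fun v => cabs (orb w 0 n v - orb w 0 n x)) (fun=> delta) z.
  + have -> : (fun v => cabs (orb w 0 n v - orb w 0 n x)) =
        fun v => cabs (orb_poly w 0 n - (orb w 0 n x)%:P).[v].
      by apply/funext => v; rewrite !hornerE horner_orb_poly.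
    exact: continuous_cabs_horner.
  + exact: cst_continuous.
  + exact: h.
  exists (Num.min e e'); first by rewrite lt_min e0.
  move=> v; rewrite lt_min => /andP[v1 /He' /ltW /inK v2]; apply: He => //.
  by rewrite orb_add.
- by rewrite horner_orb_poly.
- by rewrite horner_orb_poly cabsC.
- by [].
exists z0; first by apply: (@survive_le w 0 0 (n + m)) => //; exact: ZK.
by move=> z /H /ZK.
Qed.

(** If [a] and [b] differ, every good time [n] yields a disk of the fixed radius [7 * d / 24] that
    survives up to [n + m]. A finite net of half that mesh, with an escaping point near each of its
    points, provides one time [K] by which every such disk contains an escaped point; a good time
    beyond [K] is a contradiction. *)
Theorem connected_survivors_trivial w m X a b : (forall i, cabs (w i) <= M) ->
  (forall N, exists2 n, (N <= n)%N & good_time w m n) ->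
  (forall z0 (e : R), 0 < e -> exists2 z, cabs (z - z0) < e & exists k, rad < cabs (orb w 0 k z)) ->
  connected X -> (forall z k, X z -> cabs (orb w 0 k z) <= rad) -> X a -> X b -> a = b.
Proof.
move=> wM gd dense cX XK Xa Xb; apply/eqP; apply: contrapT => /negP ab.
have ab0 : 0 < cabs (a - b) by rewrite cabs_gt0 subr_eq0.
have [delta d0 marg] := survive_margin m.
have [|N HN] := @connected_pigeonhole rad (delta / 8); first by rewrite divr_gt0.
pose d := cabs (a - b) / N.+1%:R.
have dp : 0 < d by rewrite divr_gt0.
have [|s Hs] := @plane_net rad (7 * d / 48); first by lra.
have [K HK] : exists K : nat, forall c, c \in s ->
    exists z, cabs (z - c) < 7 * d / 48 /\ rad < cabs (orb w 0 K z).
  elim: s {Hs} => [|c s [K HK]]; first by exists 0%N.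
  have [|z zc [k zk]] := dense c (7 * d / 48); first by lra.
  have up z' k' : (k' <= maxn k K)%N -> rad < cabs (orb w 0 k' z') -> rad < cabs (orb w 0 (maxn k K) z').
    by move=> le1; rewrite !ltNge; apply: contra; exact: survive_le.
  exists (maxn k K) => c'; rewrite inE => /orP[/eqP ->|/HK[z' [h1 h2]]].
    by exists z; split => //; apply: up zk; exact: leq_maxl.
  by exists z'; split => //; apply: up h2; exact: leq_maxr.
have [n Kn gn] := gd K.
have [x [y [Xx Xy dxy nxy]]] := HN X (orb w 0 n) a b cX Xa Xb (fun z Xz => XK z n Xz).
have [z0 z0r Hz0] := surviving_disk wM gn cX XK d0 dp marg Xx Xy dxy nxy.
have [c cs cz] := Hs _ z0r; have [z [zc zK]] := HK _ cs.
have /Hz0 h : cabs (z - z0) < 7 * d / 24.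
  by have := cabs_dist z c z0; rewrite (cabsC c); lra.
have Knm : (K <= n + m)%N by exact: leq_trans Kn (leq_addr _ _).
have := survive_le wM Knm h.
by rewrite leNgt zK.
Qed.

End Bounded.
End Orbits.

(** * Invariant sets and the bifurcation radius *)

Section InvariantSets.
Variable R : realType.
Implicit Types (S K : set (C R)) (L : set (Chat R)) (c z : C R).

(** The trace in the plane of a planar [invariant_compact] set; generators suffice to test
    invariance. *)
Definition plane_invariant S K :=
  [/\ K !=set0, compact K & forall c z, S c -> K z -> K (fc c z)].

Lemma compact_preim_Some L : compact L -> planar L ->
  compact ((Some : C R -> Chat R) @^-1` L).
Proof.
move=> cL pL F FF FL.
have PF : ProperFilter ((Some : C R -> Chat R) @ F) by exact: fmap_proper_filter.
have [[z|] [Lz clz]] := cL _ PF FL; last by case: pL.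
exists z; split => // A B FA Bz.
have [|_ [[x Ax <-] [y By [yx]]]] := clz ((Some : C R -> Chat R) @` A) (Some @` B) _
    (one_point_compactification_some_nbhs _ _ Bz).
  by apply: (@filterS _ F) FA => x Ax; exists x.
by exists x; split => //; rewrite -yx.
Qed.

Lemma plane_invariant_Some S K : plane_invariant S K ->
  invariant_compact S ((Some : C R -> Chat R) @` K).
Proof.
move=> [[z Kz] cK iK]; split; first by exists (Some z); exists z.
split.
  apply: continuous_compact => //; apply: continuous_subspaceT.
  exact: one_point_compactification_some_continuous.
move=> g; elim=> {g} [c Sc|g h _ IHg _ IHh].
  by move=> _ [_ [x Kx <-] <-]; exists (fc c x) => //; exact: iK.
move=> _ [x Kx <-] /=; apply: IHg; exists (h x) => //; apply: IHh.
by exists x.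
Qed.

Lemma invariant_compact_preim S L : invariant_compact S L -> planar L ->
  plane_invariant S ((Some : C R -> Chat R) @^-1` L).
Proof.
move=> [[p Lp] [cL iL]] pL; split; last 2 first.
- exact: compact_preim_Some.
- move=> c z Sc Lz; apply: (iL _ (sg_gen Sc)); by exists (Some z).
by case: p Lp => [z Lz|//]; exists z.
Qed.

(** Zorn's lemma, in its form for unions of chains, is applied to the sets removed from [K]; by
    compactness the remainders along a chain have a common point. *)
Lemma minimal_plane_invariant S K : plane_invariant S K ->
  exists2 K', plane_invariant S K' /\ K' `<=` K &
    forall K'', plane_invariant S K'' -> K'' `<=` K' -> K'' = K'.
Proof.
move=> iK; have [K0 cK fK] := iK.
have clK : closed K by apply: compact_closed => //; exact: hausdorff_plane.
have [F FP tF|A [iA maxA]] := @Zorn_bigcup (C R) [set U | plane_invariant S (K `\` U)].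
  have [[U0 FU0]|F0] := pselect (exists U, F U); last first.
    rewrite /= bigcup0 ?setD0 // => U FU; by case: F0; exists U.
  have cl U : F U -> closed (K `\` U).
    by move=> /FP[_ ? _]; apply: compact_closed => //; exact: hausdorff_plane.
  pose G := filter_from F (fun U => K `\` U).
  have PG : ProperFilter G.
    apply: filter_from_proper; last by move=> U /FP[].
    apply: filter_from_filter; first by exists U0.
    move=> U V FU FV; case: (tF _ _ FU FV) => h; [exists V|exists U] => // x [Kx nx];
      by split; split => // y; apply: nx; exact: h.
  have GK : G K by exists U0 => // x [].
  have [p [Kp]] := cK _ PG GK; rewrite clusterE => clp.
  have DE : K `\` \bigcup_(X in F) X = K `&` \bigcap_(U in F) (K `\` U).
    apply/seteqP; split => x [Kx nx]; split => //.
      by move=> U FU; split => // Ux; apply: nx; exists U.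
    by move=> [U FU Ux]; have [_] := nx _ FU.
  split; rewrite DE.
  - exists p; split => // U FU; move/closure_id: (cl _ FU) => ->.
    by apply: clp; exists U.
  - by apply: compact_closedI => //; apply: closed_bigI.
  - move=> c z Sc [Kz nz]; split; first exact: fK.
    by move=> U FU; have [_ _ h] := FP _ FU; apply: h => //; exact: nz.
exists (K `\` A); first by split => // x [].
move=> K'' iK'' sub; apply: contrapT => ne.
have KK : K `\` ~` K'' = K''.
  apply/seteqP; split => x; first by move=> [_ /contrapT].
  by move=> Kx; split; [case: (sub _ Kx)|move=> /(_ Kx)].
apply: (maxA (~` K'')); last by rewrite /= KK.
split; first by move=> x Ax K''x; case: (sub _ K''x).
move=> h; apply: ne; rewrite -KK; congr (K `\` _).
by apply/seteqP; split => // x Ax K''x; case: (sub _ K''x).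
Qed.

(** Without minimality the property is visibly monotone in [S], which is how disks and supports are
    compared. *)
Lemma has_planar_minimal_setP S :
  has_planar_minimal_set S <-> exists K, plane_invariant S K.
Proof.
split=> [[L [[iL _] pL]]|[K iK]].
  by exists (Some @^-1` L); exact: invariant_compact_preim.
have [K' [iK' _] mK'] := minimal_plane_invariant iK.
exists (Some @` K'); split; last by case.
split; first exact: plane_invariant_Some.
move=> L' iL' sub.
have pL' : planar L' by move=> /sub[].
have E : (Some : C R -> Chat R) @^-1` L' = K'.
  apply: mK'; first exact: invariant_compact_preim.
  by move=> z /sub[y Ky [<-]].
apply/seteqP; split => // _ [z Kz <-].
by move: Kz; rewrite -E.
Qed.

Lemma plane_invariantS S S' K : S' `<=` S -> plane_invariant S K -> plane_invariant S' K.
Proof. by move=> sub [? ? h]; split => // c z /sub; exact: h. Qed.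

Lemma aligned (a : C R) (r : R) : 0 <= r ->
  exists2 b : C R, cabs b <= r & cabs (a + b) = cabs a + r.
Proof.
move=> r0; have [->|a0] := eqVneq a 0.
  by exists (r%:C%C : C R); rewrite ?add0r cabs_real ger0_norm // cabs0 add0r.
have ap : 0 < cabs a by rewrite cabs_gt0.
have q0 : 0 <= r / cabs a by rewrite divr_ge0 // ltW.
exists (((r / cabs a)%:C%C : C R) * a).
  by rewrite cabsM cabs_real ger0_norm // divfK // lt0r_neq0.
have -> : a + ((r / cabs a)%:C%C : C R) * a = ((1 + r / cabs a)%:C%C : C R) * a.
  by rewrite rmorphD rmorph1 mulrDl mul1r.
rewrite cabsM cabs_real ger0_norm; last by rewrite addr_ge0.
by rewrite mulrDl mul1r divfK // lt0r_neq0.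
Qed.

(* At a point of largest modulus the parameter can be chosen to push it outwards. *)
Lemma invariant_max_modulus c (r : R) K : 0 <= r -> plane_invariant (cball c r) K ->
  exists2 x : R, (forall z, K z -> cabs z <= x) & x ^+ 2 + r <= x + cabs c.
Proof.
move=> r0 [K0 cK iK].
have [z0 + zmax] := @compact_EVT_max _ R _ _ K0 cK (continuous_subspaceT (@continuous_cabs R)).
rewrite inE => Kz0; exists (cabs z0); first by move=> z Kz; apply: zmax; rewrite inE.
have [b br bE] := aligned (z0 ^+ 2 + c) r0.
have : K (fc (c + b) z0) by apply: iK => //; rewrite /cball /= addrAC subrr add0r.
rewrite -inE => /zmax; rewrite /fc addrA bE.
have := cabsB_ge (z0 ^+ 2) (- c); rewrite opprK cabsN cabsX; lra.
Qed.

(** The minimum of [x ^+ 2 - x] is [- 1 / 4]. *)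
Lemma invariant_radius_le c (r : R) K : 0 <= r -> plane_invariant (cball c r) K ->
  r <= cabs c + 1 / 4.
Proof.
move=> r0 iK; have [x _ xr] := invariant_max_modulus r0 iK.
have := sqr_ge0 (x - 1 / 2); rewrite !expr2 in xr *; lra.
Qed.

Lemma invariant_bounded c (r : R) K z : 0 <= r -> plane_invariant (cball c r) K ->
  K z -> cabs z <= 1 + cabs c.
Proof.
move=> r0 iK Kz; have [x xm xr] := invariant_max_modulus r0 iK.
apply: le_trans (xm _ Kz) _; rewrite leNgt; apply/negP => lt1.
have := cabs_ge0 c; rewrite expr2 in xr; nra.
Qed.

(** A fixed point of [fc c], from the quadratic formula; it shows that the supremum defining [r_bif]
    is over a nonempty set. *)
Lemma fixed_point_invariant c : exists K, plane_invariant (cball c 0) K.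
Proof.
have [s sE] := exists_sqrt (1 - 4 * c).
exists [set (1 + s) / 2]; split; [by exists ((1 + s) / 2)|exact: compact_set1|].
move=> c' z; rewrite /cball /= le_eqVlt ltNge cabs_ge0 orbF cabs_eq0 subr_eq0 => /eqP -> ->.
have two0 : (2 : C R) != 0 by rewrite pnatr_eq0.
apply: (mulfI two0); apply: (mulfI two0); rewrite /fc.
have -> : 2 * (2 * (((1 + s) / 2) ^+ 2 + c)) = (1 + s) ^+ 2 + 4 * c by field.
by rewrite sqrrD sE; field.
Qed.

Let radii c := [set r : R | 0 <= r /\ has_planar_minimal_set (cball c r)].

Lemma radii_has_sup c : has_sup (radii c).
Proof.
split; first by exists 0; split => //; apply/has_planar_minimal_setP/fixed_point_invariant.
by exists (cabs c + 1 / 4) => r [r0 /has_planar_minimal_setP[K iK]]; exact: invariant_radius_le iK.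
Qed.

Lemma le_r_bif c (r : R) : 0 <= r -> has_planar_minimal_set (cball c r) -> r <= r_bif c.
Proof. by move=> r0 h; apply: sup_upper_bound; [exact: radii_has_sup|split]. Qed.

Lemma r_bif_ge0 c : 0 <= r_bif c.
Proof. by apply: le_r_bif => //; apply/has_planar_minimal_setP/fixed_point_invariant. Qed.

Lemma cballS c (r r' : R) : r <= r' -> cball c r `<=` cball c r'.
Proof. by move=> rr z /= h; exact: le_trans rr. Qed.

Lemma lt_r_bif_invariant c (r : R) : r < r_bif c -> exists K, plane_invariant (cball c r) K.
Proof.
move=> rlt; have d0 : 0 < r_bif c - r by rewrite subr_gt0.
have [r' [_ /has_planar_minimal_setP[K iK]]] := sup_adherent d0 (radii_has_sup c).
rewrite opprB addrC subrK => h; exists K.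
by apply: plane_invariantS iK; apply: cballS; exact: ltW.
Qed.

Lemma r_bif_attained c : exists K, plane_invariant (cball c (r_bif c)) K.
Proof.
have [->|rn0] := eqVneq (r_bif c) 0; first exact: fixed_point_invariant.
have rp : 0 < r_bif c by rewrite lt_def rn0 r_bif_ge0.
pose rk (k : nat) : R := r_bif c * (1 - (k.+1%:R)^-1).
have ik k : 0 < (k.+1%:R : R)^-1 <= 1 by rewrite invr_gt0 ltr0Sn invf_le1 ?ltr0Sn // ler1n.
have rk0 k : 0 <= rk k by have /andP[? ?] := ik k; rewrite mulr_ge0 ?subr_ge0 // ltW.
have exK k : exists K, plane_invariant (cball c (rk k)) K.
  apply: lt_r_bif_invariant; have /andP[? ?] := ik k; by rewrite /rk gtr_pMr // gtrBl.
pose K k := projT1 (cid (exK k)).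
have KP k : plane_invariant (cball c (rk k)) (K k) := projT2 (cid (exK k)).
have Kb k z : K k z -> cabs z <= 1 + cabs c by exact: invariant_bounded (rk0 k) (KP k).
(* The upper limit of the sets [K k]: points approached by them for arbitrarily large [k]. *)
pose L := [set z : C R | forall (e : R) (N : nat), 0 < e ->
   exists2 k, (N <= k)%N & exists2 y, K k y & cabs (y - z) < e].
have Lb z : L z -> cabs z <= 2 + cabs c.
  move=> /(_ 1 0%N ltr01)[k _ [y /Kb h1 h2]].
  have := cabsB_ge z y; rewrite cabsC; lra.
have cL : compact L.
  apply: (bounded_closed_compact_plane _ Lb).
  rewrite closedE => z nLz e N e0; apply: contrapT => nex.
  apply: nLz; apply/nbhs_cabs; exists (e / 2); first by rewrite divr_gt0.
  move=> z' zz' Lz'; apply: nex; have [|k Nk [y Ky yz]] := Lz' (e / 2) N; first by rewrite divr_gt0.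
  by exists k => //; exists y => //; have := cabs_dist y z' z; lra.
have L0 : L !=set0.
  have exz k : exists z, K k z by have [[z Kz] _ _] := KP k; exists z.
  pose zk k := projT1 (cid (exz k)).
  have zkP k : K k (zk k) := projT2 (cid (exz k)).
  have cB : compact [set z : C R | cabs z <= 1 + cabs c].
    apply: (@bounded_closed_compact_plane _ (1 + cabs c)) => //.
    by apply: closed_le_fun; [exact: continuous_cabs|exact: cst_continuous].
  have PF : ProperFilter (zk @ \oo) by exact: fmap_proper_filter.
  have [|z [_ clz]] := cB _ PF; first by exists 0%N => // k _ /=; exact: Kb (zkP k).
  exists z => e N e0.
  have nz : nbhs z [set y | cabs (y - z) < e] by apply/nbhs_cabs; exists e.
  have [|_ [[k Nk <-] h]] := clz (zk @` [set k | (N <= k)%N]) _ _ nz.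
    by exists N => // k /= Nk; exists k.
  by exists k => //; exists (zk k).
exists L; split => // c' z /= c'r Lz e N e0.
have [t tE] : exists t : R, t = 2 * cabs z + 1 by exists (2 * cabs z + 1).
have zz := cabs_ge0 z.
have t1 : 0 < t by lra.
pose N' := maxn N (Num.bound (2 * r_bif c / e)).
have [|k N'k [y Ky yz]] := Lz (Num.min 1 (e / (2 * t))) N'.
  by rewrite lt_min ltr01 divr_gt0 // mulr_gt0.
exists k; first by apply: leq_trans N'k; exact: leq_maxl.
have /andP[k0 k1] := ik k.
have q0 : 0 <= 1 - (k.+1%:R : R)^-1 by rewrite subr_ge0.
(* Contracting [c'] towards [c] brings it into the disk of radius [rk k] and shifts the image by at
   most [r_bif c / k.+1], which [N'] makes less than [e / 2]. *)
exists (fc (c + ((1 - k.+1%:R^-1)%:C%C : C R) * (c' - c)) y).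
  have [_ _ h] := KP k; apply: h => //.
  rewrite /cball /= addrAC subrr add0r cabsM cabs_real ger0_norm // /rk mulrC.
  by rewrite ler_wpM2r.
have -> : fc (c + ((1 - k.+1%:R^-1)%:C%C : C R) * (c' - c)) y - fc c' z =
  (y - z) * ((y - z) + 2 * z) - ((k.+1%:R^-1)%:C%C : C R) * (c' - c).
  by rewrite /fc rmorphB rmorph1; ring.
apply: le_lt_trans (cabsD _ _) _; rewrite cabsN.
have h1 : cabs ((y - z) * (y - z + 2 * z)) <= e / 2.
  move: yz; rewrite lt_min ltr_pdivlMr; last by rewrite mulr_gt0.
  move=> /andP[y1 y2]; rewrite cabsM.
  have : cabs (y - z + 2 * z) <= t.
    apply: le_trans (cabsD _ _) _; by rewrite cabsM cabs2; lra.
  have := cabs_ge0 (y - z); nra.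
have h2 : cabs (((k.+1%:R^-1)%:C%C : C R) * (c' - c)) < e / 2.
  rewrite cabsM cabs_real gtr0_norm // mulrC ltr_pdivrMr ?ltr0Sn //.
  apply: le_lt_trans c'r _.
  have : 2 * r_bif c / e < k.+1%:R.
    have b0 : 0 <= 2 * r_bif c / e by rewrite divr_ge0 // ?ltW // mulr_gt0.
    apply: lt_le_trans (archi_boundP b0) _.
    by rewrite ler_nat; apply: leq_trans (leqnSn k); apply: leq_trans N'k; exact: leq_maxr.
  rewrite ltr_pdivrMr //; lra.
lra.
Qed.

(* The points whose whole semigroup orbit stays in a disk form an invariant set. *)
Lemma bounded_orbits_invariant S (B : R) z0 : S !=set0 ->
  (forall w k, (forall i, S (w i)) -> cabs (orb w 0 k z0) <= B) ->
  exists K, plane_invariant S K.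
Proof.
move=> [c0 Sc0] bz0.
exists (\bigcap_(p in [set p : (nat -> C R) * nat | forall i, S (p.1 i)])
  [set z | cabs (orb p.1 0 p.2 z) <= B]); split.
- by exists z0 => -[w k] /= Sw; exact: bz0.
- apply: (@bounded_closed_compact_plane _ B).
    apply: closed_bigI => -[w k] _ /=.
    by apply: closed_le_fun; [exact: continuous_cabs_orb|exact: cst_continuous].
  by move=> z /(_ (fun=> c0, 0%N)); apply.
- move=> c z Sc Kz [w k] /= Sw.
  have := Kz (fun i => if i is j.+1 then w j else c, k.+1).
  rewrite /= orb_recl; apply; by case.
Qed.

End InvariantSets.

(** * Julia sets *)

Section JuliaSurvivors.
Variable R : realType.
Implicit Types (w : nat -> C R) (z : C R).

Lemma increasing_choice (P : nat -> Prop) : (forall N, exists2 i, (N <= i)%N & P i) ->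
  exists psi : nat -> nat, (forall k, (psi k < psi k.+1)%N) /\ forall k, P (psi k).
Proof.
move=> H.
have ex N : exists i, (N <= i)%N /\ P i by have [i ? ?] := H N; exists i.
pose f N := projT1 (cid (ex N)).
have fP N : (N <= f N)%N /\ P (f N) := projT2 (cid (ex N)).
exists (fix psi k := if k is k'.+1 then f (psi k').+1 else f 0%N); split.
  by move=> k; have [] := fP ((fix psi k := if k is k'.+1 then f (psi k').+1 else f 0%N) k).+1.
by case=> [|k]; [have [] := fP 0%N|apply: (fP _).2].
Qed.

Lemma tends_to_infty (phi : nat -> nat) :
  (forall v, ~ forall N, exists2 i, (N <= i)%N & phi i = v) ->
  forall b, exists N, forall i, (N <= i)%N -> (b <= phi i)%N.
Proof.
move=> H; elim=> [|b [N HN]]; first by exists 0%N.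
have [N' HN'] : exists N', forall i, (N' <= i)%N -> phi i <> b.
  apply: contrapT => h; apply: (H b) => N'; apply: contrapT => h'.
  by apply: h; exists N' => i Ni E; apply: h'; exists i.
exists (maxn N N') => i; rewrite geq_max => /andP[h1 h2].
by rewrite ltn_neqAle HN // andbT eq_sym; apply/eqP; exact: HN'.
Qed.

Lemma chordal_refl (x : Chat R) : chordal x x = 0.
Proof. by case: x => //= z; rewrite subrr cabs0 mulr0 mul0r. Qed.

Lemma chordal_infty_lt z (e : R) : 0 < e -> 2 / e < cabs z ->
  chordal (Some z : Chat R) None < e.
Proof.
move=> e0; rewrite ltr_pdivrMr // => h /=.
have s0 : 0 < 1 + cabs z ^+ 2 by rewrite ltr_pwDl // sqr_ge0.
rewrite ltr_pdivrMr ?sqrtr_gt0 //; apply: lt_le_trans h _.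
rewrite mulrC ler_pM2l // -[leLHS]ger0_norm ?cabs_ge0 // -sqrtr_sqr.
by apply: ler_wsqrtr; rewrite lerDr.
Qed.

(** The iterates are normal on the open set of points escaped at time [k]. An arbitrary index
    sequence [phi] either takes some value infinitely often, which gives a constant subsequence, or
    tends to infinity, and then the doubling of moduli gives uniform convergence to infinity. *)
Lemma julia_survives (M : R) w z : 1 <= M -> (forall i, cabs (w i) <= M) -> julia w z ->
  forall k, cabs (orb w 0 k z) <= M + 2.
Proof.
move=> M1 wM Jz k; rewrite leNgt; apply/negP => esc.
apply: (Jz [set v | M + 2 < cabs (orb w 0 k v)]) => //.
  apply/open_cabs => v /= vk.
  apply: (@near_lt R (fun=> M + 2) (fun v => cabs (orb w 0 k v))) => //.
    exact: cst_continuous.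
  exact: continuous_cabs_orb.
move=> phi.
have [[v Hv]|nv] := pselect (exists v, forall N, exists2 i, (N <= i)%N & phi i = v).
  have [psi [inc psiP]] := increasing_choice Hv.
  exists psi; split => //; exists (fun x => Some (fiter w v.+1 x)).
  move=> K _ _ e e0; exists 0%N => i _ x _.
  by rewrite psiP chordal_refl.
exists id; split => //; exists (fun=> None) => K _ KU e e0.
pose l := Num.bound (2 / e).
have [|N HN] := @tends_to_infty phi _ (k + l); first by move=> v Hv; apply: nv; exists v.
exists N => i Ni x /KU /= xk; apply: chordal_infty_lt => //.
have le1 := HN _ Ni.
have kl : ((phi i).+1 = k + ((phi i).+1 - k))%N by lia.
rewrite -/(fiter w (phi i).+1 x) fiter_orb kl.
apply: le_lt_trans (@escape_orb R M M1 w 0 k _ x wM xk).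
have b0 : 0 <= 2 / e by rewrite divr_ge0 // ltW.
apply: le_trans (ltW (archi_boundP b0)) _; rewrite -/l.
set q := ((phi i).+1 - k)%N.
have lq : (l <= 2 ^ q)%N by apply: leq_trans (ltnW (ltn_expl q (isT : (1 < 2)%N))); rewrite /q; lia.
have h1 : (l%:R : R) <= 2 ^+ q by rewrite -natrX ler_nat.
apply: le_trans h1 _; rewrite ler_peMr ?exprn_ge0 //; lra.
Qed.

End JuliaSurvivors.

(** * Product measures *)

Section CountableBase.
Variable R : realType.
Implicit Types z : C R.

Definition rat_point (q : rat * rat) : C R := (ratr q.1 +i* ratr q.2)%C.

Lemma rat_point_dense z (e : R) : 0 < e -> exists q, cabs (z - rat_point q) < e.
Proof.
move=> e0.
have near (x : R) : exists q : rat, `|x - ratr q| < e / 2.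
  have [|q] := @rat_in_itvoo R (x - e / 2) (x + e / 2); first by lra.
  by rewrite in_itv /= => /andP[h1 h2]; exists q; rewrite ltr_norml; apply/andP; split; lra.
have [q1 h1] := near (complex.Re z); have [q2 h2] := near (complex.Im z).
exists (q1, q2); apply: le_lt_trans (cabs_le_coord _ _) _.
by rewrite [e]splitr; apply: ltrD.
Qed.

(** Disks with rational centre and radius the inverse of a positive integer, enumerated through
    [unpickle]; an index that codes nothing gives [set0]. *)
Definition base_disk (i : nat) : set (C R) :=
  if unpickle i is Some (q, n) then
    [set z | cabs (z - rat_point q) < ((n : nat).+1%:R)^-1]
  else set0.

Lemma open_base_disk i : open (base_disk i).
Proof.
by rewrite /base_disk; case: unpickle => [[q n]|]; [exact: open_disk|exact: open0].
Qed.

Lemma base_disk_exists z (e : R) : 0 < e ->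
  exists2 i, base_disk i z & base_disk i `<=` [set v | cabs (v - z) < e].
Proof.
move=> e0; pose n := Num.bound (2 / e).
have n0 : 0 < (n.+1%:R : R)^-1 by rewrite invr_gt0.
have ne : 2 * (n.+1%:R : R)^-1 < e.
  rewrite ltr_pdivrMr // mulrC -ltr_pdivrMr //.
  have b0 : 0 <= 2 / e by rewrite divr_ge0 // ltW.
  by apply: lt_le_trans (archi_boundP b0) _; rewrite ler_nat.
have [q zq] := rat_point_dense z n0.
exists (pickle (q, n)); rewrite /base_disk pickleK //= => v vq.
have := cabs_dist v (rat_point q) z; rewrite (cabsC (rat_point q)) => h.
apply: le_lt_trans h _; apply: lt_trans ne; rewrite [ltRHS]mulr_natl mulr2n; exact: ltrD.
Qed.

End CountableBase.

(** * Independence of a block of parameters from the past *)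

Section ProductMeasure.
Variables (R : realType) (mu : probability (Cborel R) R) (P : probability (Omega R) R).
Hypothesis prodP : is_product_measure mu P.

Definition coord_cylinders (n : nat) : set (set (Omega R)) :=
  [set B | exists A : nat -> set (C R),
    (forall i, measurable (A i : set (Cborel R))) /\ B = cyl n A].

Definition coord_algebra (n : nat) : set (set (Omega R)) := <<s coord_cylinders n >>.

Lemma measurable_open (U : set (C R)) : open U -> measurable (U : set (Cborel R)).
Proof. by move=> oU; apply: sub_sigma_algebra. Qed.

Lemma measurable_cyl n (A : nat -> set (C R)) :
  (forall i, measurable (A i : set (Cborel R))) -> measurable (cyl n A : set (Omega R)).
Proof. by move=> mA; apply: sub_sigma_algebra; exists n, A. Qed.

Lemma coord_algebra_measurable n (A : set (Omega R)) : coord_algebra n A -> measurable A.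
Proof.
apply: smallest_sub => [|B [E [mE ->]]]; first exact: sigma_algebra_measurable.
exact: measurable_cyl.
Qed.

Lemma coord_algebraC n (A : set (Omega R)) : coord_algebra n A -> coord_algebra n (~` A).
Proof.
have [_ h _] := smallest_sigma_algebra setT (coord_cylinders n).
by move=> /h; rewrite setTD.
Qed.

Lemma coord_algebra_bigcup n (F : (set (Omega R))^nat) :
  (forall k, coord_algebra n (F k)) -> coord_algebra n (\bigcup_k F k).
Proof. by have [_ _ h] := smallest_sigma_algebra setT (coord_cylinders n); exact: h. Qed.

Lemma coord_algebra0 n : coord_algebra n set0.
Proof. by have [] := smallest_sigma_algebra setT (coord_cylinders n). Qed.

Lemma coord_algebraI n (A B : set (Omega R)) :
  coord_algebra n A -> coord_algebra n B -> coord_algebra n (A `&` B).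
Proof.
move=> mA mB; rewrite -[A `&` B]setCK setCI -bigcup2E; apply: coord_algebraC.
apply: coord_algebra_bigcup => -[|[|k]]; [exact: coord_algebraC|exact: coord_algebraC|].
exact: coord_algebra0.
Qed.

Lemma coord_algebraD n (A B : set (Omega R)) :
  coord_algebra n A -> coord_algebra n B -> coord_algebra n (A `\` B).
Proof. by move=> mA mB; rewrite setDE; apply: coord_algebraI => //; exact: coord_algebraC. Qed.

Definition coord_open (n : nat) (S : set (Omega R)) :=
  forall w : nat -> C R, S w -> exists2 e : R, 0 < e &
    forall w' : nat -> C R, (forall i, (i < n)%N -> cabs (w' i - w i) < e) -> S w'.

(** An open condition on the first [n] parameters is a countable union of cylinders with sides in
    the countable base, indexed by finite sequences of integers. *)
Lemma coord_open_algebra n (S : set (Omega R)) : coord_open n S -> coord_algebra n S.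
Proof.
move=> oS.
pose cs (s : seq nat) : set (Omega R) := cyl n (fun i => @base_disk R (nth 0%N s i)).
pose F (k : nat) : set (Omega R) :=
  if unpickle k is Some s then if `[< cs s `<=` S >] then cs s else set0 else set0.
have -> : S = \bigcup_k F k.
  apply/seteqP; split => w.
    move=> /oS[e e0 He].
    have ex i : exists b, @base_disk R b (w i) /\ @base_disk R b `<=` [set v | cabs (v - w i) < e].
      by have [b ? ?] := base_disk_exists (w i) e0; exists b.
    pose b i := projT1 (cid (ex i)).
    have bP i : @base_disk R (b i) (w i) /\ @base_disk R (b i) `<=` [set v | cabs (v - w i) < e] :=
      projT2 (cid (ex i)).
    have nthb i : (i < n)%N -> nth 0%N (mkseq b n) i = b i by move=> lt; rewrite nth_mkseq.
    exists (pickle (mkseq b n)) => //; rewrite /F pickleK.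
    case: asboolP => [_ i lt|[]]; first by rewrite nthb //; have [] := bP i.
    move=> w' w'P; apply: He => i lt; have [_] := bP i; apply.
    by have := w'P i lt; rewrite nthb.
  move=> [k _]; rewrite /F; case: unpickle => // s; by case: asboolP => // h /h.
apply: coord_algebra_bigcup => k; rewrite /F.
case: unpickle => [s|]; last exact: coord_algebra0.
case: asboolP => _; last exact: coord_algebra0.
apply: sub_sigma_algebra; exists (fun i => @base_disk R (nth 0%N s i)); split => // i.
by apply: measurable_open; exact: open_base_disk.
Qed.

Definition block n N (E : nat -> set (C R)) : set (Omega R) :=
  [set w : nat -> C R | forall i, (i < N)%N -> E i (w (n + i)%N)].

Lemma block_cyl n N (E A : nat -> set (C R)) :
  (cyl n A : set (Omega R)) `&` block n N E =
  cyl (n + N) (fun i => if (i < n)%N then A i else E (i - n)%N).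
Proof.
apply/seteqP; split => w.
  move=> [wA wE] i iN; case: ltnP => ni; first exact: wA.
  by have := wE (i - n)%N; rewrite subnKC //; apply; lia.
move=> h; split => [i lt|i lt].
  by have := h i; rewrite lt; apply; lia.
have ni : (n + i < n)%N = false by lia.
by have := h (n + i)%N; rewrite ni addKn; apply; lia.
Qed.

Lemma measurable_block n N (E : nat -> set (C R)) :
  (forall i, measurable (E i : set (Cborel R))) -> measurable (block n N E).
Proof.
move=> mE; rewrite (_ : block n N E = cyl n (fun=> setT) `&` block n N E).
  by rewrite block_cyl; apply: measurable_cyl => i; case: ifP.
by rewrite setIidr // => w _ i _.
Qed.

Local Open Scope ereal_scope.

(** Dynkin's argument: the identity holds on cylinders of length [n], which are stable under
    intersection, and the events satisfying it form a lambda system. *)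
Lemma block_independent n N (E : nat -> set (C R)) (A : set (Omega R)) :
  (forall i, measurable (E i : set (Cborel R))) -> coord_algebra n A ->
  P (A `&` block n N E) = P A * \prod_(i < N) mu (E i : set (Cborel R)).
Proof.
move=> mE; set p := \prod_(i < N) _; set B := block n N E.
have mB : measurable B by exact: measurable_block.
have pB (A' : nat -> set (C R)) : (forall i, measurable (A' i : set (Cborel R))) ->
    P ((cyl n A' : set (Omega R)) `&` B) = P (cyl n A' : set (Omega R)) * p.
  move=> mA'; rewrite block_cyl !prodP //; last by move=> i; case: ifP.
  rewrite big_split_ord /=; congr (_ * _).
    by apply: eq_bigr => i _; rewrite ltn_ord.
  by apply: eq_bigr => i _; rewrite [(n + i < n)%N]ltnNge leq_addr /= addKn.
have PBp : P B = p.
  have := pB (fun=> setT) (fun=> measurableT).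
  rewrite (_ : cyl n (fun=> setT) = setT); last by apply/seteqP; split => // w _ i _.
  by rewrite setTI probability_setT mul1e.
suff: coord_algebra n `<=` [set A | measurable A /\ P (A `&` B) = P A * p].
  by move=> h /h[].
apply: lambda_system_subset.
- move=> X Y [A1 [m1 ->]] [A2 [m2 ->]]; exists (fun i => A1 i `&` A2 i); split.
    by move=> i; exact: measurableI.
  apply/seteqP; split => w; first by move=> [h1 h2] i lt; split; [exact: h1|exact: h2].
  by move=> h; split => i lt; have [] := h i lt.
- apply/dynkin_lambda_system; split.
  + by split => //; rewrite setTI probability_setT mul1e.
  + move=> X [mX PX]; split; first exact: measurableC.
    have -> : ~` X `&` B = B `\` (X `&` B).
      by apply/seteqP; split => w; [move=> [? ?]; split => // -[]|move=> [? h]; split => // ?; apply: h].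
    have -> : P (B `\` (X `&` B)) = P B - P (X `&` B).
      have XB : B `&` (X `&` B) = X `&` B by rewrite setICA setIid.
      rewrite -[X in _ - P X]XB; apply: measureD => //; first exact: measurableI.
      by rewrite (le_lt_trans (probability_le1 _ _)) ?ltry.
    rewrite PX PBp probability_setC // -PBp.
    have /fineK <- : P X \is a fin_num by rewrite fin_num_measure.
    have /fineK <- : P B \is a fin_num by rewrite fin_num_measure.
    rewrite -EFinM -EFinB -[1]/(1%:E) -EFinB -EFinM; congr (_%:E); ring.
  + move=> F tF FP; split; first by apply: bigcupT_measurable => k; have [] := FP k.
    have mF k : measurable (F k) by have [] := FP k.
    have bigP (G : nat -> set (Omega R)) : (forall k, measurable (G k)) -> trivIset setT G ->
        P (\bigcup_k G k) = \sum_(0 <= k <oo) P (G k).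
      move=> mG tG; rewrite measure_bigcup //.
      by apply: eq_eseriesl => k; rewrite in_setT.
    rewrite setI_bigcupl (bigP (fun k => F k `&` B)) ?bigP //; last 2 first.
    * by move=> k; exact: measurableI.
    * by apply: trivIset_setIr.
    under eq_eseriesr do rewrite (FP _).2.
    have /fineK pE : P B \is a fin_num by rewrite fin_num_measure.
    rewrite -PBp -pE muleC -nneseriesZl //.
    by apply: eq_eseriesr => k _; rewrite muleC.
- by move=> X [A' [mA' ->]]; split; [exact: measurable_cyl|exact: pB].
- by [].
Qed.

End ProductMeasure.

(** * Survival probabilities *)

Section JointContinuity.
Variable R : realType.
Implicit Types (w : nat -> C R) (z u : C R).

Lemma orb_joint_continuous w j k z (eta : R) : 0 < eta ->
  exists2 e : R, 0 < e & forall w' u,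
    (forall i, (i < k)%N -> cabs (w' (j + i)%N - w (j + i)%N) < e) -> cabs (u - z) < e ->
    cabs (orb w' j k u - orb w j k z) < eta.
Proof.
elim: k eta => [|k IH] eta eta0; first by exists eta.
set o := orb w j k z; have o0 := cabs_ge0 o.
have e'0 : 0 < Num.min 1 (eta / 2 / (1 + 2 * cabs o)).
  by rewrite lt_min ltr01 divr_gt0 ?divr_gt0 //; lra.
have [e e0 He] := IH _ e'0; exists (Num.min e (eta / 2)); first by rewrite lt_min e0 divr_gt0.
move=> w' u ww; rewrite lt_min => /andP[uz _].
have := He w' u; rewrite -/o => /(_ _ uz).
have hw i : (i < k)%N -> cabs (w' (j + i)%N - w (j + i)%N) < e.
  by move=> ik; have := ww i (ltnW ik); rewrite lt_min => /andP[].
move=> /(_ hw); rewrite lt_min ltr_pdivlMr; last by lra.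
move=> /andP[h1 h2].
have := ww k (ltnSn k); rewrite lt_min => /andP[_ h3].
rewrite !orbS -/o; set o' := orb w' j k u in h1 h2 *.
have -> : o' ^+ 2 + w' (j + k)%N - (o ^+ 2 + w (j + k)%N) =
  (o' - o) * ((o' - o) + 2 * o) + (w' (j + k)%N - w (j + k)%N) by ring.
apply: le_lt_trans (cabsD _ _) _; rewrite cabsM.
have h4 : cabs (o' - o + 2 * o) <= 1 + 2 * cabs o.
  apply: le_trans (cabsD _ _) _; by rewrite cabsM cabs2; lra.
have h5 : cabs (o' - o) * cabs (o' - o + 2 * o) <= cabs (o' - o) * (1 + 2 * cabs o).
  by rewrite ler_wpM2l ?cabs_ge0.
lra.
Qed.

Lemma coord_open_orb j k z (U : set (C R)) : open U ->
  coord_open (j + k) [set w : nat -> C R | U (orb w j k z)].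
Proof.
move=> /open_cabs oU w /oU[eta eta0 Heta].
have [e e0 He] := orb_joint_continuous w j k z eta0.
exists e => // w' ww; apply: Heta; apply: He; last by rewrite subrr cabs0.
by move=> i ik; apply: ww; rewrite ltn_add2l.
Qed.

End JointContinuity.

(** * Probability that an orbit survives *)

Section Survival.
Variables (R : realType) (mu : probability (Cborel R) R) (P : probability (Omega R) R).
Hypothesis prodP : is_product_measure mu P.

Definition pr (A : set (Omega R)) : R := fine (P A).

Lemma prE A : measurable A -> P A = (pr A)%:E.
Proof. by move=> mA; rewrite /pr fineK // fin_num_measure. Qed.

Lemma pr_ge0 A : 0 <= pr A.
Proof. by rewrite fine_ge0. Qed.

Lemma pr_le1 A : measurable A -> pr A <= 1.
Proof. by move=> mA; rewrite -lee_fin -prE // probability_le1. Qed.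

Lemma pr_le A B : measurable A -> measurable B -> A `<=` B -> pr A <= pr B.
Proof. by move=> mA mB AB; rewrite -lee_fin -!prE //; apply: le_measure => //; rewrite inE. Qed.

Lemma prDI A B : measurable A -> measurable B -> pr A = pr (A `\` B) + pr (A `&` B).
Proof.
move=> mA mB.
have mD : measurable (A `\` B) by exact: measurableD.
have mI : measurable (A `&` B) by exact: measurableI.
by apply: EFin_inj; rewrite EFinD -!prE //; exact: measureDI.
Qed.

Lemma pr_block n N (E : nat -> set (C R)) (A : set (Omega R)) :
  (forall i, measurable (E i : set (Cborel R))) -> coord_algebra n A ->
  pr (A `&` block n N E) = pr A * \prod_(i < N) fine (mu (E i : set (Cborel R))).
Proof.
move=> mE cA.
have mA := coord_algebra_measurable cA.
have mB := @measurable_block R n N E mE.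
apply: EFin_inj; rewrite EFinM -!prE //; last exact: measurableI.
rewrite (block_independent prodP) // -prodEFin; congr (_ * _)%E.
by apply: eq_bigr => i _; rewrite fineK // fin_num_measure.
Qed.

(** On each [V l], known at time [n], the next [N] parameters fall in [E l] with probability at
    least [p], independently of the past, and nothing of [A'] is left there. Removing one [V l] at a
    time makes the pieces disjoint, so that the losses add up. *)
Lemma pr_avoid_blocks n N m (V : nat -> set (Omega R)) (E : nat -> nat -> set (C R)) (p : R)
    (A A' : set (Omega R)) :
  coord_algebra n A -> (forall l, coord_algebra n (V l)) ->
  (forall l i, measurable (E l i : set (Cborel R))) ->
  (forall l, (l < m)%N -> p <= \prod_(i < N) fine (mu (E l i : set (Cborel R)))) ->
  measurable A' -> A' `<=` A ->
  (forall w, A w -> exists2 l, (l < m)%N & V l w) ->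
  (forall l w, (l < m)%N -> A' w -> V l w -> ~ block n N (E l) w) ->
  pr A' <= (1 - p) * pr A.
Proof.
move=> cA cV mE; elim: m A A' cA => [|m IH] A A' cA pE mA' sub cov avoid.
  have A0 : A = set0 by apply/seteqP; split => // w /cov[].
  have A'0 : A' = set0 by apply/seteqP; split => // w /sub; rewrite A0.
  by rewrite A0 A'0 /pr measure0 mulr0.
have mA := coord_algebra_measurable cA; have mV := coord_algebra_measurable (cV m).
rewrite (prDI mA mV) (prDI mA' mV) mulrDr; apply: lerD.
  apply: IH.
  - exact: coord_algebraD.
  - by move=> l lm; apply: pE; exact: ltnW.
  - exact: measurableD.
  - by move=> w [/sub ? ?]; split.
  - move=> w [/cov[l + Vl] nV]; rewrite ltnS leq_eqVlt => /orP[/eqP lm|lm]; last by exists l.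
    by case: nV; rewrite -lm.
  - by move=> l w lm [A'w _]; apply: avoid => //; exact: ltnW.
have cAV : coord_algebra n (A `&` V m) by exact: coord_algebraI.
have mAV := coord_algebra_measurable cAV.
have mB := @measurable_block R n N (E m) (mE m).
apply: (@le_trans _ _ (pr ((A `&` V m) `\` block n N (E m)))).
  apply: pr_le; [exact: measurableI|exact: measurableD|].
  by move=> w [A'w Vw]; split; [split => //; exact: sub|exact: (avoid m)].
have := prDI mAV mB; rewrite pr_block //.
have := pE m (ltnSn m); have := pr_ge0 (A `&` V m).
set q := \prod_(i < N) _; set x := pr (A `&` V m) => x0 pq.
have : x * p <= x * q by rewrite ler_wpM2l.
lra.
Qed.

Variable M : R.
Local Notation rad := (M + 2).

(** Survival is required at every step up to [k], so that the events decrease in [k] without any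
    bound on the parameters. *)
Definition surviving j z k : set (Omega R) :=
  [set w : nat -> C R | forall i, (i <= k)%N -> cabs (orb w j i z) <= rad].

Lemma surviving_algebra j z k : coord_algebra (j + k) (surviving j z k).
Proof.
rewrite -[surviving j z k]setCK; apply: coord_algebraC; apply: coord_open_algebra => w nS.
have [i ik esc] : exists2 i, (i <= k)%N & rad < cabs (orb w j i z).
  apply: contrapT => h; apply: nS => i ik; rewrite leNgt; apply/negP => lt1.
  by apply: h; exists i.
have oU : open [set u : C R | rad < cabs u].
  apply/open_cabs => u /= ru; apply: (@near_lt R (fun=> rad) (@cabs R)) => //.
    exact: cst_continuous.
  exact: continuous_cabs.
have [e e0 He] := coord_open_orb oU (w := w) esc.
exists e => // w' ww sw; have : rad < cabs (orb w' j i z).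
  by apply: He => l li; apply: ww; apply: leq_trans li _; rewrite leq_add2l.
by have := sw i ik; rewrite leNgt => /negP.
Qed.

Lemma measurable_surviving j z k : measurable (surviving j z k).
Proof. exact: coord_algebra_measurable (@surviving_algebra j z k). Qed.

(** * Geometric decay from a finite cover by escape events *)

Section Decay.
Variables (N m : nat) (p : R) (U : nat -> set (C R)) (E : nat -> nat -> set (C R)).
Hypotheses (N0 : (0 < N)%N) (p0 : 0 <= p) (p1 : p <= 1) (oU : forall l, open (U l))
  (mE : forall l i, measurable (E l i : set (Cborel R)))
  (pE : forall l, (l < m)%N -> p <= \prod_(i < N) fine (mu (E l i : set (Cborel R))))
  (cov : forall u, cabs u <= rad -> exists2 l, (l < m)%N & U l u)
  (esc : forall l u (w : nat -> C R) j, (l < m)%N -> U l u ->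
     (forall i, (i < N)%N -> E l i (w (j + i)%N)) ->
     exists2 k, (k <= N)%N & rad < cabs (orb w j k u)).

Lemma surviving_step j z k :
  pr (surviving j z (k + N)) <= (1 - p) * pr (surviving j z k).
Proof.
apply: (@pr_avoid_blocks (j + k) N m (fun l => [set w : nat -> C R | U l (orb w j k z)]) E) => //.
- exact: surviving_algebra.
- by move=> l; apply: coord_open_algebra; exact: coord_open_orb.
- exact: measurable_surviving.
- by move=> w sw i ik; apply: sw; apply: leq_trans ik _; exact: leq_addr.
- by move=> w sw; apply: cov; exact: sw.
move=> l w lm sw Uw bw; have [i iN] := esc lm Uw bw.
by rewrite -orb_add ltNge sw // leq_add2l.
Qed.

Lemma surviving_decay j z k : pr (surviving j z k) <= (1 - p) ^+ (k %/ N).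
Proof.
have q0 : 0 <= 1 - p by rewrite subr_ge0.
rewrite {1}(divn_eq k N) addnC; elim: (k %/ N)%N => [|q IH].
  by rewrite expr0; apply: pr_le1; exact: measurable_surviving.
rewrite mulSn (addnC N) addnA exprS; apply: le_trans (surviving_step _ _ _) _.
by rewrite ler_wpM2l.
Qed.

(** A shift by [N] multiplies the terms by [1 - p]. The sum is thus at most its first [N] terms plus
    [1 - p] times itself, a bound uniform in [n]. *)
Lemma decay_sum (n a : nat) : p * \sum_(i < n) (1 - p) ^+ ((a + i) %/ N) <= N%:R * (1 - p) ^+ (a %/ N).
Proof.
have q0 : 0 <= 1 - p by rewrite subr_ge0.
pose th i := (1 - p) ^+ (i %/ N); rewrite -/(th a).
have thS i : th (i + N)%N = (1 - p) * th i.
  by rewrite /th divnDr ?dvdnn // divnn N0 addn1 exprS.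
have th0 i : 0 <= th i by rewrite exprn_ge0.
have thle i l : th (i + l)%N <= th i.
  have p0' := p0; rewrite /th; have [s ->] : exists s, ((i + l) %/ N = i %/ N + s)%N.
    exists ((i + l) %/ N - i %/ N)%N; rewrite subnKC //; apply: leq_div2r; exact: leq_addr.
  rewrite exprD ler_piMr ?exprn_ge0 // exprn_ile1 //; lra.
set A := \sum_(i < n) _.
have h1 : A <= \sum_(i < N + n) th (a + i)%N.
  rewrite addnC big_split_ord /= lerDl sumr_ge0 // => i _; exact: th0.
have h2 : \sum_(i < N + n) th (a + i)%N <= N%:R * th a + (1 - p) * A.
  rewrite big_split_ord /=; apply: lerD.
    rewrite -[N in N%:R](card_ord N) -sumr_const mulr_suml; apply: ler_sum => i _.
    by rewrite mul1r thle.
  rewrite mulr_sumr; apply: ler_sum => i _.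
  by rewrite addnCA addnC thS -/(th _).
have := le_trans h1 h2; lra.
Qed.

End Decay.
End Survival.

(** * Typical parameter sequences *)

Section Typical.
Variables (R : realType) (mu : probability (Cborel R) R).

Lemma supp_disk_gt0 z (e : R) : supp mu z -> 0 < e ->
  0 < fine (mu ([set v : C R | cabs (v - z) < e] : set (Cborel R))).
Proof.
move=> sz e0; apply: fine_gt0; apply/andP; split; first exact: sz _ e0.
by apply: le_lt_trans (ltry 1); apply: probability_le1; apply: measurable_open; exact: open_disk.
Qed.

(** A word in the support that expels [z] also expels nearby points, as do all nearby words, and
    these have positive probability by definition of the support. Finitely many such neighbourhoods
    cover the escape disk. *)
Lemma escape_cover (M : R) :
  (forall z : C R, exists (w : nat -> C R) k,
    (forall i, supp mu (w i)) /\ M + 2 < cabs (orb w 0 k z)) ->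
  exists (N m : nat) (p : R) (U : nat -> set (C R)) (E : nat -> nat -> set (C R)),
  [/\ (0 < N)%N, 0 < p, p <= 1, forall l, open (U l) &
   [/\ forall l i, measurable (E l i : set (Cborel R)),
      forall l, (l < m)%N -> p <= \prod_(i < N) fine (mu (E l i : set (Cborel R))),
      forall u, cabs u <= M + 2 -> exists2 l, (l < m)%N & U l u &
      forall l u (w : nat -> C R) j, (l < m)%N -> U l u ->
       (forall i, (i < N)%N -> E l i (w (j + i)%N)) ->
       exists2 k, (k <= N)%N & M + 2 < cabs (orb w j k u)]].
Proof.
move=> escape.
have loc z : exists q : (nat -> C R) * nat * R, [/\ forall i, supp mu (q.1.1 i), 0 < q.2 &
    forall w u, (forall i, (i < q.1.2)%N -> cabs (w i - q.1.1 i) < q.2) -> cabs (u - z) < q.2 ->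
      M + 2 < cabs (orb w 0 q.1.2 u)].
  have [w [k [sw esc]]] := escape z.
  have [|e e0 He] := @orb_joint_continuous _ w 0 k z (cabs (orb w 0 k z) - (M + 2)).
    by rewrite subr_gt0.
  exists (w, k, e); split => // w' u ww uz; have := He w' u ww uz.
  have := cabsB_ge (orb w 0 k z) (orb w' 0 k u); rewrite cabsC /=; lra.
pose q z := projT1 (cid (loc z)).
have qP z : [/\ forall i, supp mu ((q z).1.1 i), 0 < (q z).2 &
    forall w u, (forall i, (i < (q z).1.2)%N -> cabs (w i - (q z).1.1 i) < (q z).2) ->
      cabs (u - z) < (q z).2 -> M + 2 < cabs (orb w 0 (q z).1.2 u)] := projT2 (cid (loc z)).
pose D z : set (C R) := [set u | cabs (u - z) < (q z).2].
(* Words are padded with [setT], of probability 1, to reach a common length. *)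
pose F z (i : nat) : set (C R) :=
  if (i < (q z).1.2)%N then [set v | cabs (v - (q z).1.1 i) < (q z).2] else setT.
have mF z i : measurable (F z i : set (Cborel R)).
  by rewrite /F; case: ifP => _ //; apply: measurable_open; exact: open_disk.
have F0 z i : 0 < fine (mu (F z i : set (Cborel R))).
  rewrite /F; case: ifP => _; last by rewrite probability_setT.
  by have [sq q0 _] := qP z; exact: supp_disk_gt0.
have cD : compact [set u : C R | cabs u <= M + 2].
  apply: (@bounded_closed_compact_plane _ (M + 2)) => //.
  by apply: closed_le_fun; [exact: continuous_cabs|exact: cst_continuous].
have := cD; rewrite compact_cover => /(_ (C R) setT D).
case=> [z _|u _|D' _ cov]; first exact: open_disk.
  by exists u => //; rewrite /D /= subrr cabs0; have [] := qP u.
pose s : seq (C R) := finmap.enum_fset D'.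
have [N HN] : exists N : nat, forall z, z \in s -> ((q z).1.2 <= N)%N.
  elim: s => [|z s [N HN]]; first by exists 0%N.
  exists (maxn (q z).1.2 N) => z'; rewrite inE => /orP[/eqP ->|/HN h]; first exact: leq_maxl.
  by apply: leq_trans h _; exact: leq_maxr.
have [p [p0 p1 Hp]] : exists p : R, [/\ 0 < p, p <= 1 & forall z, z \in s ->
    p <= \prod_(i < N.+1) fine (mu (F z i : set (Cborel R)))].
  elim: s {HN} => [|z s [p [p0 p1 Hp]]]; first by exists 1.
  exists (Num.min p (\prod_(i < N.+1) fine (mu (F z i : set (Cborel R))))); split.
  - by rewrite lt_min p0 prodr_gt0.
  - by rewrite ge_min p1.
  - by move=> z'; rewrite inE ge_min => /orP[/eqP ->|/Hp ->//]; rewrite lexx orbT.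
exists N.+1, (size s), p, (fun l => D (nth 0 s l)), (fun l => F (nth 0 s l)); split => //.
  by move=> l; exact: open_disk.
split.
- by move=> l i; exact: mF.
- by move=> l ls; apply: Hp; exact: mem_nth.
- move=> u /cov[z zD' uz]; exists (index z s); first by rewrite index_mem.
  by rewrite nth_index.
- move=> l u w j ls Du Fw; set z := nth 0 s l in Du Fw.
  have kN : ((q z).1.2 <= N)%N by apply: HN; exact: mem_nth.
  exists (q z).1.2; first exact: leqW.
  have [_ _ h] := qP z.
  apply: (h (fun i => w (j + i)%N) u) => // i ik.
  have := Fw i; rewrite /F ik; apply; exact: leq_trans ik (leqW kN).
Qed.

(** The complement of the support is covered by the null disks of the countable base. *)
Lemma supp_compl_negligible : mu.-negligible (~` supp mu : set (Cborel R)).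
Proof.
pose B i : set (Cborel R) := if mu (@base_disk R i : set (Cborel R)) == 0%E then @base_disk R i else set0.
apply: (@negligibleS _ _ _ _ (\bigcup_i B i)).
  move=> z /= nz.
  have [e e0 me] : exists2 e : R, 0 < e & ~ (0 < mu ([set v : C R | (cabs (v - (z : C R)) < e)%R] : set (Cborel R)))%E.
    by apply: contrapT => h; apply: nz => e e0 /=; apply: contrapT => h'; apply: h; exists e.
  have [i zi sub] := base_disk_exists (z : C R) e0.
  exists i => //; rewrite /B; case: eqP => // ne; case: ne.
  apply/eqP; rewrite eq_le measure_ge0 andbT leNgt; apply/negP => lt1; apply: me.
  apply: lt_le_trans lt1 _; apply: le_measure => //; rewrite inE; apply: measurable_open.
    exact: open_base_disk.
  exact: open_disk.
apply: negligible_bigcup => i; rewrite /B; case: eqP => [E|_]; last exact: negligible_set0.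
apply/negligibleP => //; apply: measurable_open; exact: open_base_disk.
Qed.

Variable P : probability (Omega R) R.
Hypothesis prodP : is_product_measure mu P.

(** [Omega] contains all sequences in the plane; this restores the restriction to the product of the
    supports. *)
Lemma coords_in_supp : P.-negligible [set w : Omega R | exists i, ~ supp mu ((w : nat -> C R) i)].
Proof.
have [N [mN N0 sub]] := supp_compl_negligible.
pose A (i j : nat) : set (C R) := if j == i then (N : set (C R)) else setT.
have mA i j : measurable (A i j : set (Cborel R)) by rewrite /A; case: ifP.
apply: (@negligibleS _ _ _ _ (\bigcup_i (cyl i.+1 (A i) : set (Omega R)))).
  move=> w [i nw]; exists i => // j ji; rewrite /A; case: eqP => // ->; exact: sub.
apply: negligible_bigcup => i.
have c0 : P (cyl i.+1 (A i) : set (Omega R)) = 0%E.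
  by rewrite prodP // big_ord_recr /= /A eqxx N0 mule0.
exists (cyl i.+1 (A i)); split; [exact: measurable_cyl|exact: c0|by []].
Qed.

Lemma pr_negligible (A : set (Omega R)) :
  measurable A -> (forall e : R, 0 < e -> pr P A <= e) -> P.-negligible A.
Proof.
move=> mA h; have PA0 : P A = 0%E.
  rewrite prE //; congr (_%:E); apply/eqP; rewrite eq_le pr_ge0 andbT.
  by apply/ler_addgt0Pr => e e0; rewrite add0r; exact: h.
by exists A; split; [exact: mA|exact: PA0|].
Qed.

(** * Almost sure escape of rational points and recurrence of good times *)

Section Escaping.
Variables (M : R) (N : nat) (p : R).
Hypotheses (N0 : (0 < N)%N) (p0 : 0 < p) (p1 : p <= 1)
  (decay : forall j z k, pr P (surviving M j z k) <= (1 - p) ^+ (k %/ N))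
  (dsum : forall n a : nat,
    p * \sum_(i < n) (1 - p) ^+ ((a + i) %/ N) <= N%:R * (1 - p) ^+ (a %/ N)).

Lemma decay_small (e : R) : 0 < e -> exists k, (1 - p) ^+ (k %/ N) < e.
Proof.
move=> e0; have p0' := p0; have p1' := p1.
have h : `|1 - p| < 1 by rewrite ger0_norm; lra.
have /cvgrPdist_lt /(_ _ e0) [k _ Hk] := cvg_expr h.
exists (k * N)%N; rewrite mulnK //; have := Hk k (leqnn k); rewrite sub0r normrN /=.
by apply: le_lt_trans; exact: ler_norm.
Qed.

Lemma rational_points_escape :
  P.-negligible [set w : Omega R | exists q, forall k, cabs (orb w 0 k (@rat_point R q)) <= M + 2].
Proof.
pose S q : set (Omega R) := \bigcap_k surviving M 0 (@rat_point R q) k.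
apply: (@negligibleS _ _ _ _ (\bigcup_i (if unpickle i is Some q then S q else set0))).
  move=> w [q Hq]; exists (pickle q); first by [].
  by rewrite pickleK => k _ i _; exact: Hq.
apply: negligible_bigcup => i; case: unpickle => [q|]; last exact: negligible_set0.
have mS : measurable (S q) by apply: bigcapT_measurable => k; exact: measurable_surviving.
apply: pr_negligible => // e e0; have [k Hk] := decay_small e0.
apply: le_trans (ltW Hk); apply: le_trans (decay 0 (@rat_point R q) k).
apply: pr_le => //; first exact: measurable_surviving.
by move=> w; apply.
Qed.

(* The critical point started at time [n - i.+1] has not escaped at time [n + m]. *)
Definition bad_time m n : set (Omega R) :=
  \big[setU/set0]_(i < n) surviving M (n - i.+1) 0 (m.+1 + i).

Lemma bad_time_intro m n i (w : Omega R) : (i < n)%N ->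
  surviving M (n - i.+1) 0 (m.+1 + i) w -> bad_time m n w.
Proof. by move=> lt h; rewrite /bad_time (bigD1 (Ordinal lt)) //=; left. Qed.

Lemma measurable_bad_time m n : measurable (bad_time m n).
Proof. by apply: bigsetU_measurable => i _; exact: measurable_surviving. Qed.

(** Boole's inequality and [decay_sum]. Starting times are counted backwards from [n], so the
    survival lengths [m.+1 + i] do not involve [n]; the bound is uniform in [n] and small for large
    [m]. *)
Lemma bad_time_le m n : pr P (bad_time m n) <= N%:R / p * (1 - p) ^+ (m.+1 %/ N).
Proof.
rewrite mulrAC ler_pdivlMr // mulrC; apply: le_trans (dsum n m.+1).
rewrite ler_pM2l // -lee_fin -prE; last exact: measurable_bad_time.
have mS i : measurable (surviving M (n - i.+1) 0 (m.+1 + i)) by exact: measurable_surviving.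
have boole : (P (bad_time m n) <=
    \sum_(i < n) P (surviving M (n - i.+1)%N 0%R (m.+1 + i)%N))%E.
  exact: Boole_inequality (fun i _ => mS i).
apply: le_trans boole _.
by rewrite -sumEFin; apply: lee_sum => i _; rewrite prE // lee_fin.
Qed.

(** For fixed [m], the event that all late times are bad is an increasing limit of events [F m K],
    each inside [bad_time m K]; its probability obeys the same bound, which tends to 0 as [m]
    grows. *)
Lemma eventually_bad_negligible :
  P.-negligible [set w : Omega R | forall m, exists K, forall n, (K <= n)%N -> bad_time m n w].
Proof.
pose F m K : set (Omega R) := \bigcap_(n in [set n | (K <= n)%N]) bad_time m n.
have mF m K : measurable (F m K).
  by apply: bigcap_measurable => [|n _]; [exists K => /=|exact: measurable_bad_time].
pose W m := \bigcup_K F m K.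
have mW m : measurable (W m) by exact: bigcupT_measurable.
have mI : measurable (\bigcap_m W m) by exact: bigcapT_measurable.
apply: (@negligibleS _ _ _ _ (\bigcap_m W m)).
  by move=> w h m _; have [K HK] := h m; exists K.
apply: pr_negligible => // e e0.
have Np : 0 < N%:R / p by rewrite divr_gt0 // ltr0n.
have [|k Hk] := @decay_small (e / (N%:R / p)); first by rewrite divr_gt0.
have [m Hm] : exists m, N%:R / p * (1 - p) ^+ (m.+1 %/ N) < e.
  (* For this [m], [m.+1 %/ N] equals [(k %/ N).+1]. *)
  exists (k %/ N * N + N.-1)%N; rewrite -addnS prednK // divnDr ?dvdnn // mulnK // divnn N0 addn1.
  rewrite mulrC -ltr_pdivlMr //; apply: le_lt_trans Hk; rewrite exprS.
  have p0' := p0; have p1' := p1.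
  rewrite ler_piMl ?exprn_ge0 //; lra.
apply: (@le_trans _ _ (pr P (W m))); first by apply: pr_le => // w; apply.
rewrite -lee_fin -prE //.
have cv := @nondecreasing_cvg_mu _ _ _ P (F m) (mF m) (mW m) _.
have {}cv : (P \o F m) @ \oo --> P (W m).
  apply: cv => i j ij; apply/subsetPset => w h n jn; apply: h; exact: leq_trans ij jn.
rewrite -(cvg_lim _ cv) //; apply: lime_le; first by apply/cvg_ex; exists (P (W m)).
near=> K; rewrite /= prE // lee_fin; apply: le_trans (ltW Hm); apply: le_trans (bad_time_le m K).
by apply: pr_le => //; [exact: measurable_bad_time|move=> w; apply => /=].
Unshelve. all: by end_near. Qed.

End Escaping.
End Typical.

(** * From typical sequences to totally disconnected Julia sets *)

Section TotalDisconnectedness.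
Variable R : realType.
Implicit Types (c z : C R).

(** Points outside the interior and within [r + 1] of [c] form a compact set, whose least distance
    to [c] exceeds [r]. This yields a radius strictly beyond [r_bif c]. *)
Lemma cball_interior_margin c (r : R) (S : set (C R)) :
  cball c r `<=` interior S -> exists2 r', r < r' & cball c r' `<=` S.
Proof.
move=> sub.
have cdist : continuous (fun z : C R => cabs (z - c)).
  have -> : (fun z : C R => cabs (z - c)) = fun z => cabs ('X - c%:P).[z].
    by apply/funext => z; rewrite !hornerE.
  exact: continuous_cabs_horner.
pose T := cball c (r + 1) `&` ~` interior S.
have cT : compact T.
  apply: compact_closedI; last by apply: open_closedC; exact: open_interior.
  apply: (@bounded_closed_compact_plane _ (r + 1 + cabs c)).
    by apply: closed_le_fun; [exact: cdist|exact: cst_continuous].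
  by move=> z; rewrite /cball /= => zc; have := cabsB_ge z c; lra.
have [T0|T0] := pselect (T !=set0); last first.
  exists (r + 1); first by lra.
  move=> z zc; apply: interior_subset; apply: contrapT => nz; apply: T0; by exists z.
have [z0 /set_mem[z0c nz0] zmin] := compact_EVT_min T0 cT (continuous_subspaceT cdist).
have rz0 : r < cabs (z0 - c) by rewrite ltNge; apply/negP => h; apply: nz0; exact: sub.
exists ((r + cabs (z0 - c)) / 2); first by lra.
move=> z; rewrite /cball /= => zc; apply: interior_subset; apply: contrapT => nz.
have : T z by split => //; move: z0c; rewrite /cball /=; lra.
by move=> /mem_set /zmin; lra.
Qed.

Lemma survivors_totally_disconnected (M : R) (w : nat -> C R) m :
  1 <= M -> (forall i, cabs (w i) <= M) ->
  (forall K, exists2 n, (K <= n)%N & ~ bad_time M m n w) ->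
  (forall q, exists k, M + 2 < cabs (orb w 0 k (@rat_point R q))) ->
  totally_disconnected (julia w).
Proof.
move=> M1 wM good dense x Jx; apply/seteqP; split => y; last first.
  by move=> ->; exact: connected_component_refl.
move=> Xy.
have Xx : connected_component (julia w) x x by exact: connected_component_refl.
suff -> : x = y by [].
apply: (@connected_survivors_trivial R M M1 w m (connected_component (julia w) x) x y wM _ _ _ _ Xx Xy).
- move=> K; have [n Kn gn] := good K; exists n => // j jn.
  rewrite ltNge; apply/negP => h; apply: gn.
  (* Counted backwards from [n], the starting time [j] has index [n - j.+1]. *)
  apply: (@bad_time_intro R M m n (n - j.+1)%N); first by lia.
  have -> : (n - (n - j.+1).+1 = j)%N by lia.
  have -> : (m.+1 + (n - j.+1) = n + m - j)%N by lia.
  by move=> i ik; exact: survive_le h.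
- move=> z0 e e0; have [q zq] := rat_point_dense z0 e0.
  by exists (@rat_point R q); [rewrite cabsC|exact: dense].
- exact: component_connected.
- move=> z k /connected_component_sub Jz; exact: julia_survives.
Qed.

End TotalDisconnectedness.

Unset Implicit Arguments.

Theorem theorem5p1 (R : realType) (mu : probability (Cborel R) R) :
  compact (supp mu) ->
  ((exists c : C R, supp mu `<=` cball c (r_bif c)) ->
     has_planar_minimal_set (supp mu)) /\
  ((exists c : C R, cball c (r_bif c) `<=` interior (supp mu)) ->
     forall P : probability (Omega R) R, is_product_measure mu P ->
     {ae P, forall w : Omega R, totally_disconnected (julia w)}).
Proof.
move=> cs; split=> [[c sub]|[c sub] P prodP].
  apply/has_planar_minimal_setP; have [K iK] := r_bif_attained c.
  by exists K; exact: plane_invariantS iK.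
have [r rr sub'] := cball_interior_margin sub.
have r0 : 0 <= r by apply: le_trans (ltW rr); exact: r_bif_ge0.
(* An invariant set for [supp mu] would also be invariant for the disk of radius [r] inside it,
   although [r] exceeds [r_bif c]. *)
have noinv : ~ exists K, plane_invariant (supp mu) K.
  move=> [K iK]; move: rr; rewrite ltNge => /negP; apply; apply: le_r_bif => //.
  by apply/has_planar_minimal_setP; exists K; exact: plane_invariantS iK.
have [M0 HM0] := compact_bounded_plane cs.
pose M := Num.max 1 M0.
have M1 : 1 <= M by rewrite le_max lexx.
have HM z : supp mu z -> cabs z <= M by move=> /HM0 h; rewrite le_max h orbT.
(* A point that no word in [supp mu] expels would yield an invariant set by
   [bounded_orbits_invariant]. *)
have escape z : exists (w : nat -> C R) k,
    (forall i, supp mu (w i)) /\ M + 2 < cabs (orb w 0 k z).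
  apply: contrapT => h; apply: noinv.
  apply: (@bounded_orbits_invariant R (supp mu) (M + 2) z).
    by exists c; apply: sub'; rewrite /cball /= subrr cabs0.
  move=> w k sw; rewrite leNgt; apply/negP => esc; apply: h; by exists w, k.
have [N [m [p [U [E [N0 p0 p1 oU [mE pE cov esc]]]]]]] := escape_cover escape.
have decay := @surviving_decay R mu P prodP M N m p U E p1 oU mE pE cov esc.
have dsum := @decay_sum R N p N0 (ltW p0) p1.
(* The exceptional sequences have a parameter off the support, or a rational point that never
   escapes, or no delay [m] with infinitely many good times. *)
apply: (@negligibleS _ _ _ _ ([set w : Omega R | exists i, ~ supp mu ((w : nat -> C R) i)] `|`
  ([set w : Omega R | exists q, forall k, cabs (orb w 0 k (@rat_point R q)) <= M + 2] `|`
   [set w : Omega R | forall m, exists K, forall n, (K <= n)%N -> bad_time M m n w]))).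
  move=> w /= ntd; apply: contrapT => nb; apply: ntd.
  have sw i : supp mu ((w : nat -> C R) i).
    by apply: contrapT => h; apply: nb; left; exists i.
  have [m' Hm'] : exists m', forall K, exists2 n, (K <= n)%N & ~ bad_time M m' n w.
    apply: contrapT => h; apply: nb; right; right => m'.
    apply: contrapT => h'; apply: h; exists m' => K; apply: contrapT => h''.
    by apply: h'; exists K => n Kn; apply: contrapT => h3; apply: h''; exists n.
  apply: (survivors_totally_disconnected M1 _ Hm').
    by move=> i; exact: HM.
  move=> q; apply: contrapT => h; apply: nb; right; left; exists q => k.
  by rewrite leNgt; apply/negP => lt1; apply: h; exists k.
apply: negligibleU; first exact: coords_in_supp prodP.
by apply: negligibleU; [exact: rational_points_escape decay|exact: eventually_bad_negligible decay dsum].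
Qed.
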